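(* Let $s\geq 3$ be an integer. Then there exist constants $c_1,c_2>0$, depending only on $s$, such that for every sufficiently large $n$ the threshold bias of the diameter game $\mathcal{D}_{s,n}$ satisfies $$c_1 n^{1-1/\lceil s/2\rceil}\leq b_{\mathcal{D}_{s,n}}\leq c_2 n^{1-1/\lceil s/2\rceil}.$$
   Context: A $(1:b)$ Maker-Breaker game on a finite board $X$ with a family of winning sets: Maker and Breaker alternately claim unclaimed elements of $X$, Maker $1$ per round and Breaker $b$ per round, until all are claimed; Maker wins if she claims all elements of some winning set, otherwise Breaker wins. The threshold bias is the unique integer $b_0$ such that Breaker wins the $(1:b)$ game iff $b\geq b_0$. The diameter game $\mathcal{D}_{s,n}$ is the Maker-Breaker game played on the edge set of $K_n$ in which Maker wins iff her graph at the end of the game is a spanning subgraph of $K_n$ of diameter at most $s$, i.e., every two vertices are joined by a path of Maker's edges of length at most $s$. *)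

(* Defs.v *)
From mathcomp Require Import ssreflect ssrfun ssrbool eqtype ssrnat seq path fintype finset.
Set Implicit Arguments. Unset Strict Implicit. Unset Printing Implicit Defensive.

(* Board X : {set T}; W : predicate on Maker's final set of elements.
   Maker moves first, claiming 1 free element per round; Breaker then claims
   b free elements (or all remaining free elements if fewer than b remain).
   The game ends when every element of X is claimed; Maker wins iff W holds
   for her final set.
   [maker_wins_from X W b fuel M B] : Maker (to move, having claimed M,
   Breaker having claimed B) has a strategy guaranteeing a win. *)
Fixpoint maker_wins_from (T : finType) (X : {set T}) (W : {set T} -> Prop)
  (b fuel : nat) (M B : {set T}) : Prop :=
  match fuel with
  | 0 => W M
  | f.+1 =>
    let F := X :\: (M :|: B) in
    if F == set0 then W M else
    exists x, x \in F /\
      let M' := x |: M in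
      let F' := F :\ x in
      if F' == set0 then W M' else
      forall S : {set T}, S \subset F' -> #|S| = minn b #|F'| ->
        maker_wins_from X W b f M' (B :|: S)
  end.

(* Maker has a winning strategy in the (1:b) game (each Maker move claims an
   element, so #|X|.+1 rounds of fuel suffice). *)
Definition maker_wins (T : finType) (X : {set T}) (W : {set T} -> Prop) (b : nat) : Prop :=
  maker_wins_from X W b #|X|.+1 set0 set0.

(* Finite game of perfect information: Breaker wins iff Maker has no winning strategy. *)
Definition breaker_wins (T : finType) (X : {set T}) (W : {set T} -> Prop) (b : nat) : Prop :=
  ~ maker_wins X W b.

Definition Kn_edges (n : nat) : {set 'I_n * 'I_n} :=
  [set e : 'I_n * 'I_n | (e.1 < e.2)%N].

Definition adj (n : nat) (M : {set 'I_n * 'I_n}) : rel 'I_n :=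
  fun u v => ((u, v) \in M) || ((v, u) \in M).

Definition diam_at_most (n s : nat) (M : {set 'I_n * 'I_n}) : Prop :=
  forall u v : 'I_n, exists p : seq 'I_n,
    (size p <= s)%N /\ path (adj M) u p /\ last u p = v.

Definition diam_breaker_wins (s n b : nat) : Prop :=
  breaker_wins (Kn_edges n) (diam_at_most s) b.

(* Main.v *)
From Stdlib Require Import Reals Lra Classical.
Require Import Defs.
From mathcomp Require Import all_boot all_order all_algebra zify.
From mathcomp Require ring lra.
Set Implicit Arguments. Unset Strict Implicit. Unset Printing Implicit Defensive.

(* Write k = ceil(s/2) and let b be the bias.

   Breaker, with b a large multiple of n^(1-1/k), separates two vertices u and v.
   As long as few vertices are touched he can answer each Maker edge by claiming all
   edges between the growing classes R (containing u) and L (containing v), and use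
   half of his bias to exhaust all edges at the vertices touched so far.  Exhausting k-1
   generations in this way makes the balls of radius k-1 around u and v final while
   they have at most b vertices.  From then on a pairing strategy (when Maker joins x
   to one ball, Breaker cuts x off from the other) excludes paths of length 2k.

   Maker, with b a small multiple of n^(1-1/k), lets every vertex choose d (about
   n^(1/k)) out-neighbours.  Potentials control simultaneously
   - that a vertex makes its choices before many edges at it are claimed,
   - that sets S of at most n^(1-2/k) vertices expand: their choices do not fall into a
     set of q|S| vertices,
   - that for S, S' of size about n^(1-2/k) some edge between the chosen neighbourhoods
     of S and S' is Maker's.
   The last two are bad events (witnesses) weighted by their conditional probability
   under uniformly random future choices, times a Beck-type factor counting Breaker's
   edges; a factor 4 per open choice absorbs the dependence on Breaker's answers.
   Then balls of radius k-2 have n^(1-2/k) vertices and any two of them are at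
   distance at most 3, giving diameter 2k-1. *)

(** * Maker-Breaker games *)

Section Game.
Variables (T : finType) (X : {set T}) (W : {set T} -> Prop).
Implicit Types (M B S F : {set T}) (b : nat).

Definition unclaimed M B : {set T} := X :\: (M :|: B).

Lemma in_unclaimed M B x : (x \in unclaimed M B) = [&& x \in X, x \notin M & x \notin B].
Proof. by rewrite !inE negb_or andbC andbA. Qed.

Lemma unclaimed_after M B S x : S \subset unclaimed M B :\ x ->
  unclaimed (x |: M) (B :|: S) = (unclaimed M B :\ x) :\: S.
Proof.
move=> sub; apply/setP=> y; rewrite !inE.
by case: (y == x); case: (y \in M); case: (y \in B); case: (y \in S); case: (y \in X).
Qed.

(** Breaker must claim exactly [minn b #|F|] elements, so a smaller planned answer is padded inside
    [F]. *)
Lemma set_between S F b : S \subset F -> #|S| <= b ->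
  exists S' : {set T}, [/\ S \subset S', S' \subset F & #|S'| = minn b #|F|].
Proof.
move=> sub; elim: b => [|b IH]; first by exists S; rewrite min0n; split=> //; lia.
rewrite leq_eqVlt => /orP[/eqP eS|].
  exists S; split=> //; have := subset_leq_card sub; lia.
rewrite ltnS => /IH[S' [s1 s2 s3]].
have [Fb|Fb] := leqP #|F| b; first by exists S'; split=> //; lia.
have : S' != F by apply: contraTneq Fb => e; rewrite -leqNgt; rewrite e in s3; lia.
rewrite eqEsubset s2 /= => /subsetPn[y yF yS].
exists (y |: S'); split; last by rewrite cardsU1 yS; lia.
  by apply: (subset_trans s1); apply: subsetUr.
by rewrite subUset sub1set yF.
Qed.

(** The fuel exceeds the number of unclaimed elements, so the game ends first. Answers smaller than
    [b] are allowed, which covers Maker claiming the last element ([S] empty). *)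
Lemma maker_strategy b (Inv : {set T} -> {set T} -> Prop) :
  (forall M B, Inv M B -> unclaimed M B != set0 ->
     exists2 x, x \in unclaimed M B &
       forall S, S \subset unclaimed M B :\ x -> #|S| <= b -> Inv (x |: M) (B :|: S)) ->
  (forall M B, Inv M B -> unclaimed M B = set0 -> W M) ->
  Inv set0 set0 -> maker_wins X W b.
Proof.
move=> step final; rewrite /maker_wins => inv0.
have lt0 : #|unclaimed set0 set0| < #|X|.+1.
  by rewrite ltnS subset_leq_card // subsetDl.
move: lt0 inv0; elim: #|X|.+1 set0 {1 3 5}set0 => [|f IH] B M //= lef inv.
case: eqP => [F0|/eqP Fn0]; first exact: final inv F0.
have [x xF hx] := step _ _ inv Fn0; exists x; split=> //.
have cF : #|unclaimed M B :\ x| < f.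
  by rewrite [#|unclaimed M B|](cardsD1 x) xF in lef; lia.
case: eqP => [F0|/eqP F'n0].
  have := hx set0 (sub0set _); rewrite cards0 => /(_ isT) /final; apply.
  by rewrite unclaimed_after ?sub0set // setD0.
move=> S sS cS; apply: IH; last by apply: hx => //; lia.
rewrite unclaimed_after //; apply: leq_ltn_trans cF.
by rewrite subset_leq_card // subsetDl.
Qed.

(** [Inv] has to survive every enlargement [S'] of the planned answer, because the rules force
    Breaker to use his whole bias. *)
Lemma breaker_strategy b (Inv : {set T} -> {set T} -> Prop) :
  (forall M B x, Inv M B -> x \in unclaimed M B ->
     exists2 S : {set T}, S \subset unclaimed M B :\ x & #|S| <= b /\
       forall S', S \subset S' -> S' \subset unclaimed M B :\ x ->
         Inv (x |: M) (B :|: S')) ->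
  (forall M B, Inv M B -> unclaimed M B = set0 -> ~ W M) ->
  Inv set0 set0 -> breaker_wins X W b.
Proof.
move=> step final; rewrite /breaker_wins /maker_wins => inv0.
have lt0 : #|unclaimed set0 set0| < #|X|.+1.
  by rewrite ltnS subset_leq_card // subsetDl.
move: lt0 inv0; elim: #|X|.+1 set0 {1 3 5}set0 => [|f IH] B M //= lef inv.
case: eqP => [F0|/eqP Fn0]; first exact: final inv F0.
move=> [x [xF]].
have [S sS [cS hS]] := step _ _ _ inv xF.
have cF : #|unclaimed M B :\ x| < f.
  by rewrite [#|unclaimed M B|](cardsD1 x) xF in lef; lia.
case: eqP => [F0|/eqP F'n0].
  have := hS S (subxx _) sS => /final; apply.
  by rewrite unclaimed_after // /unclaimed F0 set0D.
have [S' [s1 s2 s3]] := set_between sS cS.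
move=> /(_ S' s2 s3); apply: IH; last exact: hS.
rewrite unclaimed_after //; apply: leq_ltn_trans cF.
by rewrite subset_leq_card // subsetDl.
Qed.

Hypothesis Wmono : forall M M', M \subset M' -> W M -> W M'.

Lemma maker_wins_from_won b f M B : W M -> maker_wins_from X W b f M B.
Proof.
elim: f M B => [|f IH] M B //= wM; case: eqP => // /eqP /set0Pn[x xF].
have wM' : W (x |: M) by apply: Wmono wM; apply: subsetUr.
by exists x; split=> //; case: eqP => // _ S _ _; apply: IH.
Qed.

(* Maker imagines that Breaker also claimed the elements of [B' :\: B]. *)
Lemma maker_wins_fromW b b' f M B B' : b <= b' -> B \subset B' ->
  maker_wins_from X W b' f M B' -> maker_wins_from X W b f M B.
Proof.
move=> leb; elim: f M B B' => [|f IH] M B B' //= sB.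
have sF : unclaimed M B' \subset unclaimed M B by rewrite setDS // setUS.
case: eqP => [F0 wM|/eqP F'n0 [x [xF H]]].
  exact: (@maker_wins_from_won b f.+1).
have Fn0 : unclaimed M B != set0 by apply/set0Pn; exists x; apply: (subsetP sF).
rewrite -/(unclaimed M B) (negPf Fn0); exists x; split; first exact: (subsetP sF).
move: H; case: eqP => [_ wM|/eqP F'n1 H].
  by case: eqP => // _ S _ _; apply: maker_wins_from_won.
case: eqP => [F0|_ S sS cS].
  case/set0Pn: F'n1 => y; rewrite 2!inE => /andP[yx /(subsetP sF) yF].
  by have := in_set0 y; rewrite -F0 2!inE yx yF.
pose F' := unclaimed M B' :\ x.
have sSF : S :&: F' \subset F' by apply: subsetIr.
have cSF : #|S :&: F'| <= b'.
  by have := subset_leq_card (subsetIl S F'); lia.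
have [S' [s1 s2 s3]] := set_between sSF cSF.
apply: IH (H S' s2 s3); apply/subsetP=> y; rewrite !inE => /orP[yB|yS].
  by rewrite (subsetP sB).
have := subsetP sS _ yS; rewrite !inE => /andP[yx /andP[/norP[yM _] yX]].
case yB': (y \in B') => //=; apply: (subsetP s1).
by rewrite !inE yS yx (negPf yM) yB' yX.
Qed.

Lemma maker_winsW b b' : b <= b' -> maker_wins X W b' -> maker_wins X W b.
Proof. by move=> leb; apply: maker_wins_fromW. Qed.

End Game.

(** * Breaker's strategy *)

Definition walk (V : Type) (e : rel V) (l : nat) (x y : V) : Prop :=
  exists p : seq V, (size p <= l)%N /\ path e x p /\ last x p = y.

Section Walk.
Variables (V : Type) (e : rel V).

Lemma walk0 x : walk e 0 x x. Proof. by exists [::]. Qed.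

Lemma walk1 x y : e x y -> walk e 1 x y.
Proof. by move=> exy; exists [:: y]; rewrite /= exy. Qed.

Lemma walkW l l' x y : l <= l' -> walk e l x y -> walk e l' x y.
Proof. by move=> le [p [sp pp]]; exists p; split=> //; apply: leq_trans sp le. Qed.

Lemma walk_mono (e' : rel V) l x y :
  subrel e e' -> walk e l x y -> walk e' l x y.
Proof. by move=> sub [p [sp [pp lp]]]; exists p; rewrite (sub_path sub pp). Qed.

Lemma walk_cat l l' x y z : walk e l x y -> walk e l' y z -> walk e (l + l') x z.
Proof.
move=> [p [sp [pp lp]]] [p' [sp' [pp' lp']]]; exists (p ++ p').
by rewrite size_cat leq_add // cat_path pp lp pp' last_cat lp.
Qed.

Lemma walk_split l l' x y : walk e (l + l') x y ->
  exists2 z, walk e l x z & walk e l' z y.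
Proof.
move=> [p [sp [pp lp]]]; move: pp lp; rewrite -{1 2}[p](cat_take_drop l).
rewrite cat_path last_cat => /andP[p1 p2] lp.
exists (last x (take l p)); first by exists (take l p); rewrite size_take_min geq_minl.
by exists (drop l p); rewrite size_drop; split=> //; lia.
Qed.

Lemma walk_sym l x y : symmetric e -> walk e l x y -> walk e l y x.
Proof.
move=> es [p [sp [pp lp]]]; exists (rev (belast x p)).
rewrite size_rev size_belast -{1}lp rev_path.
split=> //; split; first by rewrite -(eq_path (e:=e)).
by case: p lp {sp pp} => //= a p lp; rewrite rev_cons last_rcons.
Qed.

End Walk.

(** * Edges of the complete graph *)

Section Edge.
Variable n : nat.
Implicit Types (x y : 'I_n) (M B : {set 'I_n * 'I_n}) (A T : {set 'I_n}).

Definition edge x y : 'I_n * 'I_n := if x < y then (x, y) else (y, x).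

Lemma edgeC x y : edge x y = edge y x.
Proof. by rewrite /edge; case: ltngtP => // /val_inj ->. Qed.

Lemma edge_Kn x y : (edge x y \in Kn_edges n) = (x != y).
Proof. rewrite inE /edge -val_eqE /=; by case: (ltngtP x y) => h /=; rewrite ?h ?ltnn. Qed.

Lemma Kn_edge e : e \in Kn_edges n -> e = edge e.1 e.2.
Proof. by case: e => x y; rewrite inE /edge /= => ->. Qed.

Lemma edge_eq x y z w :
  edge x y = edge z w -> (x = z /\ y = w) \/ (x = w /\ y = z).
Proof. by rewrite /edge; case: ifP; case: ifP => _ _ [-> ->]; auto. Qed.

Lemma adj_edge M x y : M \subset Kn_edges n -> adj M x y = (edge x y \in M).
Proof.
move=> MK; rewrite /adj; apply/orP/idP.
  by case=> h; move/subsetP/(_ _ h): MK => /Kn_edge /= eM; rewrite -?eM // edgeC -eM.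
by rewrite /edge; case: ifP; auto.
Qed.

Lemma adjC M : symmetric (adj M). Proof. by move=> x y; rewrite /adj orbC. Qed.

Definition incident T : {set 'I_n * 'I_n} := [set e | (e.1 \in T) || (e.2 \in T)].

Lemma incident_edge T x y : (edge x y \in incident T) = (x \in T) || (y \in T).
Proof. by rewrite inE /edge; case: ifP => //= _; rewrite orbC. Qed.

Definition between A T : {set 'I_n * 'I_n} := [set edge x y | x in A, y in T].

Lemma card_between A T : #|between A T| <= #|A| * #|T|.
Proof.
rewrite /between curry_imset2X -cardsX; exact: leq_imset_card.
Qed.

Lemma edge_between A T x y : x \in A -> y \in T -> edge x y \in between A T.
Proof. by move=> xA yT; apply/imset2P; exists x y. Qed.

Lemma card_incident_Kn T : #|Kn_edges n :&: incident T| <= #|T| * n.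
Proof.
rewrite -[X in _ * X](card_ord n) -[X in _ * X]cardsT.
apply: leq_trans (card_between T setT); apply: subset_leq_card.
apply/subsetP=> e; rewrite inE => /andP[/Kn_edge -> ].
rewrite incident_edge => /orP[] h; last rewrite edgeC.
  exact: edge_between h (in_setT _).
exact: edge_between h (in_setT _).
Qed.

End Edge.

(* Breaker's bias is [4 * h]: at most [2 * h] edges keep [R] and [L] separated, the
   others exhaust the edges at [T]. *)
Section BreakerSide.
Variables (n q h r : nat).
Hypotheses (n_ge4 : 4 <= n) (q_ge4 : 4 <= q) (r_gt0 : 0 < r).
(** In the end [r] is k-1, [q] about n^(1/k) and [h] about 4n/q. The first bound limits the vertices
    touched in a stage, the second keeps [R] and [L] within the bias. *)
Hypotheses (n_le : 4 * n <= h * q) (h_ge : 4 * q ^ r <= h).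
Notation V := 'I_n.
Notation Kn := (Kn_edges n).
Notation free := (unclaimed Kn).
Implicit Types (u v x y z : V) (M B S : {set V * V}) (R L T : {set V}).

(** Edges that Maker has or may still get. This graph only shrinks, so a set containing a ball of it
    contains the ball of Maker's final graph. *)
Definition unblocked B : rel V := [rel x y | (x != y) && (edge x y \notin B)].

Lemma unblockedC B : symmetric (unblocked B).
Proof. by move=> x y; rewrite /unblocked /= eq_sym edgeC. Qed.

Definition ball B l u T := forall z, walk (unblocked B) l u z -> z \in T.

Lemma ball_mono B B' l u T : B \subset B' -> ball B l u T -> ball B' l u T.
Proof.
move=> sB bl z w; apply: bl; apply: walk_mono w => x y /andP[xy h0].
by rewrite /unblocked /= xy; apply: contra h0; apply: (subsetP sB).
Qed.

Definition separated M B R L : Prop :=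
  [/\ M \subset Kn, [disjoint M & B], [disjoint R & L] &
      forall x y, x \in R -> y \in L -> edge x y \in B].

Definition monochromatic M R L := forall x y, edge x y \in M ->
  (x \in R) && (y \in R) || (x \in L) && (y \in L).

(* The inequality with [n + h] is the clock of a stage: each round touches at most two
   new vertices and removes [2 * h] unclaimed edges at [T]. *)
Definition closing M B : Prop := exists i u v R L T,
  [/\ [/\ i < r, separated M B R L & monochromatic M R L],
      T \subset R :|: L, #|T| <= 4 * q ^ i,
      h * #|R :|: L| + #|free M B :&: incident T| <= #|T| * (n + h) &
      [/\ u \in R, v \in L, ball B i u (T :&: R) & ball B i v (T :&: L)]].

Definition guarded M B R L := forall x a c, x \notin R :|: L ->
  a \in R -> c \in L ->
  (edge x a \in M -> edge x c \in B) /\ (edge x c \in M -> edge x a \in B).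

(** Second phase: the classes are frozen and have at most [h] vertices, so one move can cut a vertex
    off from a whole class. *)
Definition pairing M B : Prop := exists u v R L,
  [/\ separated M B R L, #|R :|: L| <= 4 * q ^ r,
      guarded M B R L, v \in L & ball B r u R /\ ball B r v L].

Lemma separated_step M B R L e S R' L' : separated M B R L -> e \in free M B ->
  S \subset free M B :\ e -> [disjoint R' & L'] ->
  (forall x y, x \in R' -> y \in L' -> edge x y \in B :|: S) ->
  separated (e |: M) (B :|: S) R' L'.
Proof.
move=> [MK MB RL cross] eF sS RL' cross'; split=> //.
  by rewrite subUset MK sub1set andbT; move: eF; rewrite in_unclaimed => /and3P[].
apply/pred0P=> g /=; apply/negbTE; rewrite !inE; apply/negP=> /andP[h1].
have sS' := subsetP sS g; rewrite !inE in sS'.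
move: eF; rewrite in_unclaimed => /and3P[eK eM eB].
case/orP: h1 => [/eqP->|gM]; last first.
  case/orP=> [gB|/sS']; last by rewrite gM /= andbF.
  by move/pred0P/(_ g): MB => /=; rewrite gM gB.
by rewrite (negPf eB) /= => eS; move: (subsetP sS _ eS); rewrite !inE eqxx.
Qed.

(** A walk of length 2r+2 from [u] to [v] passes some [a] in [R] and then, within two steps, some
    [c] in [L]. These are distinct and not adjacent; a middle vertex is excluded by the cross edges
    if it lies in a class and by [guarded] otherwise. *)
Lemma separated_closed M B R L : separated M B R L -> free M B = set0 ->
  forall u v, u \in R -> v \in L -> ball B r u R -> ball B r v L ->
  guarded M B R L -> ~ diam_at_most (r + (2 + r)) M.
Proof.
move=> [MK MB RL cross] F0 u v uR vL bu bv gd /(_ u v) w.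
have adj_unblocked : subrel (adj M) (unblocked B).
  move=> x y; rewrite adj_edge // => xyM; rewrite /unblocked /= -edge_Kn.
  by rewrite (subsetP MK) //= (disjointFr MB).
have [a wa wav] := walk_split w.
have [c wac wc] := walk_split wav.
have aR : a \in R by apply: bu; apply: walk_mono wa.
have cL : c \in L.
  by apply: bv; apply: walk_sym (@unblockedC B) _; apply: walk_mono wc.
have notRL x : x \in R -> x \in L -> False by move=> xR; rewrite (disjointFr RL).
have notM x y : x \in R -> y \in L -> adj M x y -> False.
  by move=> xR yL /adj_unblocked/andP[_]; rewrite cross.
case: wac => [[|x [|y [|z p]]] [sz [pth lst]]]; move: sz pth lst => //= _.
- by move=> _ ac; apply: (notRL a); rewrite // ac.
- by rewrite andbT => ax xc; apply: (notM a x); rewrite // xc.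
case/and3P=> ax xy _ yc; subst y.
have [xRL|xRL] := boolP (x \in R :|: L).
  move: xRL; rewrite inE => /orP[xR|xL]; first exact: (notM x c).
  exact: (notM a x).
have [g1 _] := gd _ _ _ xRL aR cL.
have := adj_unblocked _ _ xy; rewrite /unblocked /= g1 ?andbF //.
by rewrite edgeC -adj_edge.
Qed.

(** An edge Maker can still claim does not join [R] to [L]. If it meets [L], both ends go to [L],
    otherwise to [R]. *)
Lemma recolor M B R L x y : separated M B R L -> edge x y \in free M B ->
  exists R' L', [/\ R \subset R', L \subset L',
    R' :|: L' = (R :|: L) :|: [set x; y], [disjoint R' & L'] &
    (x \in R') && (y \in R') || (x \in L') && (y \in L')].
Proof.
move=> [_ _ RL cross]; rewrite in_unclaimed => /and3P[_ _ eB].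
have [xyL|] := boolP ((x \in L) || (y \in L)).
  have notR : (x \notin R) && (y \notin R).
    apply/negPn; rewrite negb_and !negbK; apply/negP=> xyR.
    move: eB; case/orP: xyL => l; case/orP: xyR => r1; apply/negP; rewrite negbK.
    - by have := disjointFr RL r1; rewrite l.
    - by rewrite edgeC cross.
    - by rewrite cross.
    - by have := disjointFr RL r1; rewrite l.
  exists R, (L :|: [set x; y]); split; rewrite ?subsetUl ?setUA //.
    case/andP: notR => xR yR; apply/pred0P=> z /=; apply/negP.
    rewrite !inE -orbA => /andP[zR /or3P[zL|/eqP e|/eqP e]].
    - by move: zL; rewrite (disjointFr RL).
    - by rewrite -e zR in xR.
    - by rewrite -e zR in yR.
  by rewrite !inE !eqxx !orbT.
rewrite negb_or => /andP[xL yL].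
exists (R :|: [set x; y]), L; split; rewrite ?subsetUl //.
- by rewrite setUAC.
- apply/pred0P=> z /=; apply/negP.
  rewrite !inE => /andP[/or3P[zR|/eqP->|/eqP->]]; last 2 first.
  - by rewrite (negPf xL).
  - by rewrite (negPf yL).
  by rewrite (disjointFr RL).
by rewrite !inE !eqxx !orbT.
Qed.

(** Both ends of the new edge lie in one class and old cross edges are Breaker's, so each edge still
    to be claimed joins [x] or [y] to an old vertex. *)
Lemma recolor_cross M B R L x y R' L' : separated M B R L ->
  monochromatic M R L -> R \subset R' -> L \subset L' ->
  R' :|: L' = (R :|: L) :|: [set x; y] -> [disjoint R' & L'] ->
  (x \in R') && (y \in R') || (x \in L') && (y \in L') ->
  #|(free M B :\ edge x y) :&: between R' L'| <= 2 * #|R :|: L| /\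
  monochromatic (edge x y |: M) R' L' /\
  forall z w, z \in R' -> w \in L' ->
    edge z w \in B :|: ((free M B :\ edge x y) :&: between R' L').
Proof.
move=> [MK _ RL cross] mono sR sL RL'E RL' xy.
have cut z : z \in R' -> z \in L' -> False.
  by move=> zR; rewrite (disjointFr RL').
have mono' : monochromatic (edge x y |: M) R' L'.
  move=> z w; rewrite in_setU1 => /orP[/eqP/edge_eq[] [-> ->] //|/mono].
    by rewrite andbC [in X in _ || X]andbC.
  case/orP=> /andP[h1 h2]; apply/orP; [left|right].
    by rewrite !(subsetP sR).
  by rewrite !(subsetP sL).
split; last split=> // z w zR wL.
  apply: (@leq_trans #|between [set x; y] (R :|: L)|); last first.
    apply: leq_trans (card_between _ _) _; rewrite leq_mul2r.
    by rewrite cards2; case: (x != y); rewrite orbT.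
  apply/subset_leq_card/subsetP=> g; rewrite in_setI in_setD1 in_unclaimed.
  case/andP=> /and4P[gxy gK gM gB] /imset2P[z w zR wL gE].
  have hz : z \in (R :|: L) :|: [set x; y] by rewrite -RL'E inE zR.
  have hw : w \in (R :|: L) :|: [set x; y] by rewrite -RL'E inE wL orbT.
  have nzw : ~ (z \in [set x; y] /\ w \in [set x; y]).
    rewrite !inE => -[h1 h2].
    case/orP: xy => /andP[h3 h4].
      by case/orP: h2 => /eqP e; apply: (cut w); rewrite // e.
    by case/orP: h1 => /eqP e; apply: (cut z); rewrite // e.
  move: hz hw; rewrite !(in_setU _ (R :|: L)).
  case/orP=> [hz|hz]; case/orP=> [hw|hw].
  - have : g \in B; last by rewrite (negPf gB).
    rewrite gE; move: hz hw; rewrite !in_setU.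
    case/orP=> h1; case/orP=> h2.
    + by case: (cut w); rewrite // (subsetP sR).
    + exact: cross.
    + by case: (cut z); rewrite // (subsetP sL).
    + by case: (cut z); rewrite // (subsetP sL).
  - by rewrite gE edgeC edge_between.
  - by rewrite gE edge_between.
  - by case: nzw.
rewrite in_setU in_setI in_setD1 in_unclaimed edge_between // andbT edge_Kn.
have [//|eB] := boolP (edge z w \in B); rewrite /= andbT.
have zw : z != w by apply/eqP=> e; apply: (cut z); rewrite // e.
have : edge z w \notin edge x y |: M.
  apply/negP=> /mono' /orP[] /andP[h1 h2]; first exact: (cut w).
  exact: (cut z).
by rewrite in_setU1 negb_or => /andP[-> ->]; rewrite zw.
Qed.

(** The clock of the stage and 4n <= hq give c <= q^i (q + 4). The summand 2 is for the ends of
    Maker's current edge. *)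
Lemma touched_bound i t c : t <= 4 * q ^ i -> h * c <= t * (n + h) ->
  c + 2 <= 4 * q ^ i.+1.
Proof.
move=> tq hc; have q0 : 0 < q ^ i by rewrite expn_gt0; lia.
have qr : 0 < q ^ r by rewrite expn_gt0 (leq_trans _ q_ge4).
have : h * c <= h * (q ^ i * (q + 4)) by nia.
rewrite leq_pmul2l ?expnS; last by lia.
nia.
Qed.

(* Once every edge at [T] is claimed, unblocked steps from [T] are Maker edges. *)
Lemma ball_step M B R L R0 T l u : monochromatic M R L -> [disjoint R & L] ->
  free M B :&: incident T = set0 -> R0 \subset R ->
  ball B l u (T :&: R0) -> ball B l.+1 u R.
Proof.
move=> mono RL F0 sR bl z; rewrite -addn1 => w.
have [y /bl + [p [sz [pth lst]]]] := walk_split w.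
rewrite inE => /andP[yT /(subsetP sR) yR].
case: p sz pth lst => [|z' [|? ?]] //= _; first by move=> _ <-.
move=> /andP[/andP[yz yzB] _] zz; subst z'.
have : edge y z \notin free M B :&: incident T by rewrite F0 inE.
rewrite inE incident_edge yT andbT in_unclaimed edge_Kn yz yzB andbT /= negbK.
by move/mono; case/orP=> /andP[] // yL; rewrite (disjointFr RL yR) in yL.
Qed.

Lemma ball_step_sym M B R L L0 T l v : monochromatic M R L -> [disjoint R & L] ->
  free M B :&: incident T = set0 -> L0 \subset L ->
  ball B l v (T :&: L0) -> ball B l.+1 v L.
Proof.
move=> mono RL; apply: (@ball_step M B L R).
  by move=> x y /mono; rewrite orbC.
by rewrite disjoint_sym.
Qed.

(** Breaker claims the at most 2h new cross edges [C] and up to 2h free edges [Ss] at [T]. Either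
    the clock advances, or [T] is exhausted and the radius of the balls grows by one. *)
Lemma closing_step M B e : closing M B -> e \in free M B ->
  exists2 S : {set V * V}, S \subset free M B :\ e & #|S| <= 4 * h /\
    forall S', S \subset S' -> S' \subset free M B :\ e ->
      closing (e |: M) (B :|: S') \/ pairing (e |: M) (B :|: S').
Proof.
move=> [i [u [v [R [L [T [[ir sep mono] TRL cT cRL [uR vL bu bv]]]]]]]] eF.
have eE : e = edge e.1 e.2.
  by apply: Kn_edge; move: eF; rewrite in_unclaimed => /andP[].
move: e.1 e.2 eE => x y eE; subst e.
have [R' [L' [sR sL RLE RL' xy]]] := recolor sep eF.
have [cC [mono' cross']] := recolor_cross sep mono sR sL RLE RL' xy.
set C := _ :&: _ in cC cross'.
have cRLq : #|R :|: L| + 2 <= 4 * q ^ i.+1.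
  by apply: (touched_bound cT); apply: leq_trans cRL; apply: leq_addr.
have qir : q ^ i.+1 <= q ^ r by rewrite leq_exp2l // (leq_trans _ q_ge4).
have cRL' : #|R' :|: L'| <= #|R :|: L| + 2.
  rewrite RLE; apply: leq_trans (leq_card_setU _ _) _; rewrite leq_add2l.
  by rewrite cards2; case: (x != y).
set F := free M B :\ edge x y in C cC cross' *.
pose G := F :&: incident T.
have [Ss [_ SsG cSs]] : exists Ss : {set V * V},
    [/\ set0 \subset Ss, Ss \subset G & #|Ss| = minn (2 * h) #|G|].
  by apply: set_between; rewrite ?sub0set ?cards0.
exists (C :|: Ss).
  by rewrite subUset subsetIl (subset_trans SsG) ?subsetIl.
split.
  move: (leq_card_setU C Ss).1 (geq_minl (2 * h) #|G|); rewrite cSs.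
  by clear -cC cRLq qir h_ge; lia.
move=> S' sCS S'F; move: (sCS); rewrite subUset => /andP[CS' SsS'].
have sep' : separated (edge x y |: M) (B :|: S') R' L'.
  apply: separated_step sep eF S'F RL' _ => z w zR wL.
  by apply: (subsetP (setUS B CS')); apply: cross'.
have F'E := unclaimed_after S'F.
have F'G : free (edge x y |: M) (B :|: S') :&: incident T \subset G :\: Ss.
  rewrite F'E; apply/subsetP=> g; rewrite !inE => /andP[/andP[h1 ->] ->].
  by rewrite (contra (subsetP SsS' g) h1).
have bu' := ball_mono (subsetUl B S') bu.
have bv' := ball_mono (subsetUl B S') bv.
have [Gh|Gh] := leqP (2 * h) #|G|.
  left; exists i, u, v, R', L', T; split=> //.
  - by apply: subset_trans TRL _; rewrite RLE subsetUl.
  - apply: leq_trans cRL; have := subset_leq_card F'G.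
    rewrite cardsDS // cSs (minn_idPl Gh) => hF.
    have GF : #|G| <= #|free M B :&: incident T|.
      by rewrite subset_leq_card // setSI // subD1set.
    have hRL : h * #|R' :|: L'| <= h * #|R :|: L| + h * 2.
      by rewrite -mulnDr leq_mul2l cRL' orbT.
    have arith a a' f f' m : a' <= a + h * 2 -> f' <= m - 2 * h -> 2 * h <= m ->
      m <= f -> a' + f' <= a + f by clear; lia.
    exact: arith hRL hF Gh GF.
  - split; first exact: (subsetP sR).
    + exact: (subsetP sL).
    + by move=> z /bu'; rewrite !inE => /andP[-> /(subsetP sR)].
    by move=> z /bv'; rewrite !inE => /andP[-> /(subsetP sL)].
have F'0 : free (edge x y |: M) (B :|: S') :&: incident T = set0.
  apply/eqP; rewrite -subset0; apply: subset_trans F'G _.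
  by rewrite subset0 -cards_eq0 cardsDS // cSs (minn_idPr (ltnW Gh)) subnn.
have bu'' := ball_step mono' RL' F'0 sR bu'.
have bv'' := ball_step_sym mono' RL' F'0 sL bv'.
(* A new stage takes all touched vertices as [T]; its clock holds because each vertex has at most n
   edges. *)
have [ir'|ir'] := ltnP i.+1 r.
  left; exists i.+1, u, v, R', L', (R' :|: L'); split=> //.
    by clear -cRL' cRLq; lia.
    rewrite mulnDr addnC [_ * h]mulnC leq_add2r.
    apply: leq_trans (card_incident_Kn (R' :|: L')).
    by rewrite subset_leq_card // setSI // subsetDl.
  split; [exact: (subsetP sR)|exact: (subsetP sL)| |] => z; rewrite !inE.
    by move/bu'' => ->.
  by move/bv'' => ->; rewrite orbT.
have ri : i.+1 = r by apply/eqP; rewrite eqn_leq ir ir'.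
rewrite ri in bu'' bv''; right; exists u, v, R', L'; split=> //.
- by rewrite -ri; clear -cRL' cRLq; lia.
- move=> z a c; rewrite inE negb_or => /andP[zR zL] _ _.
  by split=> /mono'; rewrite (negPf zR) (negPf zL).
- exact: (subsetP sL).
Qed.

(** When Maker joins an outside vertex [x] to one class, Breaker claims all free edges from [x] to
    the other class [A]. For other Maker edges this answer is harmless. *)
Lemma pairing_step M B e : pairing M B -> e \in free M B ->
  exists2 S : {set V * V}, S \subset free M B :\ e & #|S| <= 4 * h /\
    forall S', S \subset S' -> S' \subset free M B :\ e ->
      pairing (e |: M) (B :|: S').
Proof.
move=> [u [v [R [L [sep cRL gd vL [bu bv]]]]]] eF.
have eE : e = edge e.1 e.2.
  by apply: Kn_edge; move: eF; rewrite in_unclaimed => /andP[].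
have [_ _ RL cross] := sep.
pose A := if (e.1 \in R) || (e.2 \in R) then L else R.
pose x := if (e.1 \in R :|: L) then e.2 else e.1.
pose F := free M B :\ e.
exists (F :&: between [set x] A); first exact: subsetIl.
split.
  apply: leq_trans (subset_leq_card (subsetIr _ _)) _.
  apply: leq_trans (card_between _ _) _; rewrite cards1 mul1n.
  have : #|A| <= #|R :|: L| by rewrite subset_leq_card // /A; case: ifP;
    rewrite ?subsetUl ?subsetUr.
  have qr : 0 < q ^ r by rewrite expn_gt0 (leq_trans _ q_ge4).
  by clear - qr h_ge cRL; lia.
move=> S' sS S'F.
have reply z d w : z \notin R :|: L -> d \in R :|: L -> e = edge z d ->
    w \in (if d \in R then L else R) -> z != w -> edge z w \notin e |: M ->
    edge z w \in B :|: S'.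
  move=> zRL dRL ezd wA zw zwM; rewrite inE; apply/orP; case: (boolP (_ \in B)); first by left.
  move=> zwB; right; apply: (subsetP sS); rewrite inE in_setD1 in_unclaimed edge_Kn zw zwB.
  move: zwM; rewrite in_setU1 negb_or => /andP[-> ->] /=.
  have zR : z \notin R by move: zRL; rewrite inE => /norP[].
  move: ezd; rewrite {1}eE /A /x => /edge_eq[] [-> ->].
    by rewrite (negPf zRL) (negPf zR) /= edge_between ?set11.
  by rewrite dRL (negPf zR) orbF edge_between ?set11.
exists u, v, R, L; split=> //; last first.
- by split; apply: ball_mono (subsetUl _ _) _.
- move=> z a c zRL aR cL.
  have [g1 g2] := gd z a c zRL aR cL.
  move: (zRL); rewrite inE negb_or => /andP[zR zL].
  have za : z != a by apply: contraNneq zR => ->.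
  have zc : z != c by apply: contraNneq zL => ->.
  have cR : c \in R = false by rewrite (disjointFl RL).
  have ac : a != c by apply: contraTneq aR => ->; rewrite cR.
  have aRL : a \in R :|: L by rewrite inE aR.
  have cRL' : c \in R :|: L by rewrite inE cL orbT.
  move: (eF); rewrite in_unclaimed => /and3P[_ eM eB].
  have zaz : edge z a != edge z c.
    by apply/eqP=> /edge_eq[] [h1 h2]; [rewrite h2 eqxx in ac|rewrite h1 eqxx in zc].
  split; rewrite in_setU1 => /orP[/eqP ez|zM].
  (* If [edge z c] were Maker's, the old guard would have given [edge z a] to Breaker before this
     move. *)
  + apply: (reply z a) => //; rewrite ?aR // -ez in_setU1 negb_or.
    rewrite eq_sym zaz; apply: contra eB => /g2; by rewrite ez.
  + by rewrite inE g1.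
  + apply: (reply z c) => //; rewrite ?cR // in_setU1 negb_or.
    rewrite -ez zaz; apply: contra eB => /g1; by rewrite ez.
  + by rewrite inE g2.
- by apply: (separated_step sep eF S'F RL) => z w zR wL; rewrite inE cross.
Qed.

Lemma monochromatic_disconnected M B R L s u v : separated M B R L ->
  monochromatic M R L -> u \in R -> v \in L -> ~ diam_at_most s M.
Proof.
move=> [MK _ RL _] mono uR vL /(_ u v) [p [_ [pth lst]]].
suff : v \in R by rewrite (disjointFl RL).
elim: p u uR pth lst => [u uR _ <- //|y p IH] u uR /= /andP[uy pth].
apply: IH pth; move: uy; rewrite adj_edge // => /mono.
by rewrite uR (disjointFr RL uR) orbF.
Qed.

(** After Maker's first edge xy, fresh [u] and [v] give [R] = {u, x, y} and [L] = {v}, and Breaker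
    takes the three edges between them. Stage 0 has four touched vertices, whence the 4 in the
    bounds 4 q^i. *)
Lemma breaker_start e : e \in Kn ->
  exists2 S : {set V * V}, S \subset free set0 set0 :\ e & #|S| <= 4 * h /\
    forall S', S \subset S' -> S' \subset free set0 set0 :\ e ->
      closing (e |: set0) (set0 :|: S').
Proof.
move=> eK; have eE := Kn_edge eK; move: e.1 e.2 eE eK => x y -> {e}.
rewrite edge_Kn => xy.
have [u [v [ux uy vx vy uv]]] : exists u v : V,
    [/\ u != x, u != y, v != x, v != y & u != v].
  have c2 : 1 < #|~: [set x; y]|.
    by have := cardsC [set x; y]; rewrite cards2 card_ord; lia.
  have /card_gt1P[u [v [hu hv uv]]] := c2; exists u, v.
  by move: hu hv; rewrite !inE !negb_or => /andP[-> ->] /andP[-> ->].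
pose R := u |: [set x; y]; pose L := [set v].
have RL : [disjoint R & L].
  apply/pred0P=> z /=; apply/negP; rewrite !inE => /andP[+ /eqP zv]; subst z.
  by rewrite eq_sym (negPf uv) (negPf vx) (negPf vy).
have xyR : (x \in R) && (y \in R) by rewrite !inE !eqxx !orbT.
have cR : #|R| = 3 by rewrite cardsU1 cards2 xy !inE negb_or ux uy.
have cRL : #|R :|: L| = 4.
  by rewrite cardsU (disjoint_setI0 RL) cR cards1 cards0.
have qr : 0 < q ^ r by rewrite expn_gt0 (leq_trans _ q_ge4).
have h0 : 0 < h by clear -qr h_ge; lia.
have unclaimedE : free set0 set0 = Kn by rewrite /unclaimed setU0 setD0.
rewrite unclaimedE; exists (between R L).
  apply/subsetP=> g /imset2P[z w zR wL ->].
  have zw : z != w by apply: contraTneq wL => <-; rewrite (disjointFr RL).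
  rewrite in_setD1 edge_Kn zw andbT; apply/eqP=> /edge_eq[] [h1 h2].
    by move: wL vy; rewrite h2 inE => /eqP->; rewrite eqxx.
  by move: wL vx; rewrite h2 inE => /eqP->; rewrite eqxx.
split; first by have := card_between R L; rewrite cR cards1; clear -h0; lia.
move=> S' sS S'F; rewrite setU0 set0U.
exists 0, u, v, R, L, (R :|: L); split=> //.
- split=> //; last first.
    move=> z w; rewrite inE => /eqP/edge_eq[] [-> ->]; rewrite ?xyR //.
    by case/andP: xyR => -> ->.
  split=> //.
  + by rewrite sub1set edge_Kn.
  + by rewrite disjoints1; apply/negP=> /(subsetP S'F); rewrite !inE eqxx.
  + by move=> z w zR wL; apply/(subsetP sS)/edge_between.
- by rewrite cRL expn0.
- rewrite cRL mulnDr addnC [h * 4]mulnC leq_add2r -[X in _ <= X * n]cRL.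
  apply: leq_trans (card_incident_Kn _); apply/subset_leq_card/setSI.
  exact: subsetDl.
- split.
  + by rewrite !inE eqxx.
  + by rewrite inE.
  + by move=> z [p [+ [_ <-]]]; rewrite leqn0 => /nilP->; rewrite !inE eqxx.
  + by move=> z [p [+ [_ <-]]]; rewrite leqn0 => /nilP->; rewrite !inE eqxx orbT.
Qed.

Theorem breaker_wins_diam s : s <= r + (2 + r) -> diam_breaker_wins s n (4 * h).
Proof.
move=> sr.
apply: (@breaker_strategy _ _ _ _ (fun M B => [\/ M = set0 /\ B = set0,
  closing M B | pairing M B])); last by constructor 1.
  move=> M B e [[-> ->]|cl|pr] eF.
  - have [|S sS [cS hS]] := @breaker_start e.
      by move: eF; rewrite in_unclaimed => /andP[].
    by exists S => //; split=> // S' s1 s2; constructor 2; apply: hS.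
  - have [S sS [cS hS]] := closing_step cl eF.
    exists S => //; split=> // S' s1 s2.
    by case: (hS S' s1 s2); [constructor 2|constructor 3].
  - have [S sS [cS hS]] := pairing_step pr eF.
    by exists S => //; split=> // S' s1 s2; constructor 3; apply: hS.
move=> M B [[-> ->]|cl|pr] F0 dm.
- have [x [y xy]] : exists x y : V, x != y.
    have : 1 < #|[set: V]| by rewrite cardsT card_ord; lia.
    by case/card_gt1P=> x [y [_ _ xy]]; exists x, y.
  by move/setP/(_ (edge x y)): F0; rewrite in_unclaimed edge_Kn xy !inE.
- case: cl => [i [u [v [R [L [T [[_ sep mono] _ _ _ [uR vL _ _]]]]]]]].
  exact: monochromatic_disconnected sep mono uR vL dm.
case: pr => u [v [R [L [sep _ gd vL [bu bv]]]]].
have uR : u \in R by apply: bu; apply: walkW (walk0 _ _).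
apply: (separated_closed sep F0 uR vL bu bv gd) => x y.
exact: walkW sr (dm x y).
Qed.

End BreakerSide.

(** * Maker's strategy *)

Import Order.TTheory GRing.Theory Num.Theory.
Local Open Scope ring_scope.

(** * Averaging and double counting *)

Section SumLemmas.
Implicit Types (A I : finType).

Lemma ex_argmax A (P : pred A) (f : A -> rat) : (exists x, P x) ->
  exists2 x, P x & forall y, P y -> f y <= f x.
Proof.
move=> [x0 Px0]; case: (@Order.TotalTheory.arg_maxP _ _ A x0 P f Px0) => x Px h.
by exists x.
Qed.

Lemma ex_le_average A (F : {set A}) (f : A -> rat) (t : rat) : (0 < #|F|)%N ->
  \sum_(w in F) f w <= t -> exists2 w, w \in F & f w * #|F|%:R <= t.
Proof.
move=> /card_gt0P F0 le_t; have [w wF wmin] := ex_argmax (fun w => - f w) F0.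
exists w => //; apply: le_trans le_t; rewrite mulr_natr -sumr_const.
by apply: ler_sum => y /wmin; rewrite lerN2.
Qed.

Lemma sum_incidence A I (P : pred I) (E : I -> {set A}) (S : {set A})
  (a : I -> rat) (t : rat) :
  (forall e, e \in S -> \sum_(i | P i && (e \in E i)) a i <= t) ->
  \sum_(i | P i) a i * #|E i :&: S|%:R <= #|S|%:R * t.
Proof.
move=> le_t; rewrite [leRHS]mulr_natl -sumr_const.
apply: (@le_trans _ _ (\sum_(e in S) \sum_(i | P i && (e \in E i)) a i)); last exact: ler_sum.
rewrite (exchange_big_dep P) /=; last by move=> e i _ /andP[].
apply: ler_sum => i Pi; rewrite mulr_natr -sumr_const le_eqVlt; apply/orP; left.
by apply/eqP/eq_bigl => e; rewrite inE Pi andbC.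
Qed.

End SumLemmas.

Section Growth.
Import mathcomp.algebra_tactics.ring mathcomp.algebra_tactics.lra.
Variable N : nat.
Hypothesis N_gt0 : (0 < N)%N.

(** The base of the Beck-type potentials. Its 2 keeps the cost of j <= N factors linear, at most 1 +
    j/N, while 2N factors still at least double. *)
Definition growth : rat := 1 + (2 * N)%:R^-1.

Lemma growth_ge1 : 1 <= growth.
Proof. by rewrite /growth lerDl invr_ge0 ler0n. Qed.

Lemma growth_gt0 : 0 < growth.
Proof. exact: lt_le_trans ltr01 growth_ge1. Qed.

Lemma growth_le j : (j <= N)%N -> growth ^+ j <= 1 + j%:R / N%:R.
Proof.
have N0 : (0 : rat) < N%:R by rewrite ltr0n.
elim: j => [|j IH] jN; first by rewrite mul0r addr0 expr0.
rewrite exprS; apply: le_trans (ler_wpM2l (ltW growth_gt0) (IH (ltnW jN))) _.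
rewrite /growth natrM invfM -[j.+1%:R]natr1; set m := N%:R in N0 *.
have jm : j%:R / m <= 1.
  by rewrite ler_pdivrMr // mul1r ler_nat; exact: ltnW.
have im : 0 <= m^-1 by rewrite invr_ge0 ltW.
have : m^-1 * (j%:R / m) <= m^-1 * 1 by exact: ler_wpM2l.
rewrite [(_ + 1) / m]mulrDl mul1r; move: (j%:R / m) (m^-1) im => x a; nra.
Qed.

Lemma growth_double K : 2 ^+ K <= growth ^+ (2 * N * K).
Proof.
rewrite exprM; apply: lerXn2r; rewrite ?nnegrE ?exprn_ge0 ?(ltW growth_gt0) //.
have bern j : 1 + j%:R * (2 * N)%:R^-1 <= growth ^+ j.
  elim: j => [|j IH]; first by rewrite mul0r addr0 expr0.
  rewrite exprS; apply: le_trans (ler_wpM2l (ltW growth_gt0) IH).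
  rewrite /growth -[j.+1%:R]natr1.
  have im : (0 : rat) <= (2 * N)%:R^-1 by rewrite invr_ge0 ler0n.
  have : (0 : rat) <= j%:R by rewrite ler0n.
  nra.
apply: le_trans (bern _); rewrite divff ?pnatr_eq0 ?muln_eq0 -?lt0n //.
Qed.

End Growth.

(** * Potentials and Maker's two-round cycle *)

Section MakerPotential.
Import mathcomp.algebra_tactics.ring mathcomp.algebra_tactics.lra.
Variables (n d b : nat).
Notation V := 'I_n.
Notation slot := ('I_n * 'I_d)%type.
Notation Kn := (Kn_edges n).
Notation free := (unclaimed Kn).
Implicit Types (M B S : {set V * V}) (c : {ffun slot -> option V}).
Implicit Types (x y w : V) (s : slot) (e f : V * V).

(** A cycle claims at most 2 + 2b edges, and [pace] is four times that, as [total_danger_assign]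
    requires. *)
Definition pace : nat := 8 * b.+1.
Notation N := pace.
Notation g := (growth N).

Let N_gt0 : (0 < N)%N. Proof. by rewrite /pace; lia. Qed.
Let g0 : 0 < g. Proof. exact: growth_gt0. Qed.
Let n_ge0 : (0 : rat) <= n%:R. Proof. exact: ler0n. Qed.

Variables (I : finType) (P : pred I).
(** A witness [i] is a bad event: the choices agree with [om i] on the slots [D i], and Maker has no
    edge of [E i]. *)
Variables (D : I -> {set slot}) (om : I -> slot -> V) (E : I -> {set V * V}).

Definition slot_weight c i s : rat :=
  if c s is Some w then (om i s == w)%:R else 4%:R / n%:R.

(** A Maker edge in [E i] kills the witness. Otherwise the power of [growth] rises to 1 as Breaker
    takes [E i], so a witness that comes true ends with weight 1. *)
Definition weight c M B i : rat :=
  (\prod_(s in D i) slot_weight c i s) *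
  (if [disjoint M & E i] then g ^- #|E i :\: B| else 0).

Definition total_weight c M B : rat := \sum_(i | P i) weight c M B i.

Definition assign c s w : {ffun slot -> option V} :=
  [ffun s' => if s' == s then Some w else c s'].

Lemma slot_weight_ge0 c i s : 0 <= slot_weight c i s.
Proof. by rewrite /slot_weight; case: (c s) => [w|]; rewrite ?divr_ge0 ?ler0n. Qed.

Lemma weight_ge0 c M B i : 0 <= weight c M B i.
Proof.
rewrite /weight mulr_ge0 ?prodr_ge0 // => [s _|]; first exact: slot_weight_ge0.
by case: ifP => // _; rewrite invr_ge0 exprn_ge0 // ltW.
Qed.

Lemma weight_hit c M B i e : e \in M -> e \in E i -> weight c M B i = 0.
Proof.
move=> eM eE; rewrite /weight ifF ?mulr0 //; apply/negbTE/pred0Pn.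
by exists e; rewrite /= eM.
Qed.

Lemma weight_step c M B M' S i : M \subset M' -> (#|S| <= N)%N ->
  weight c M' (B :|: S) i <= weight c M B i * (1 + #|E i :&: S|%:R / N%:R).
Proof.
move=> sM cS; rewrite /weight -mulrA ler_wpM2l ?prodr_ge0 // => [s _|].
  exact: slot_weight_ge0.
have frac : 0 <= 1 + #|E i :&: S|%:R / N%:R :> rat.
  by rewrite addr_ge0 // divr_ge0 ?ler0n.
case: ifP => [dM'|_]; last first.
  by rewrite mulr_ge0 //; case: ifP => // _; rewrite invr_ge0 exprn_ge0 // ltW.
rewrite (disjointWl sM dM').
have cES : (#|E i :&: S| <= N)%N.
  by apply: leq_trans cS; rewrite subset_leq_card // subsetIr.
have cE : (#|E i :\: B| <= #|E i :\: (B :|: S)| + #|E i :&: S|)%N.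
  apply: leq_trans (leq_card_setU _ _); apply/subset_leq_card/subsetP=> e.
  by rewrite !inE; case: (e \in S); case: (e \in B); case: (e \in E i).
apply: le_trans (ler_wpM2l _ (growth_le N_gt0 cES)); last first.
  by rewrite invr_ge0 exprn_ge0 // ltW.
rewrite ler_pdivlMl ?exprn_gt0 // ler_pdivrMr ?exprn_gt0 // -exprD addnC.
by apply: ler_weXn2l => //; exact: growth_ge1.
Qed.

Lemma weight_assign c M B s w i : s \in D i -> c s = None -> (0 < n)%N ->
  weight (assign c s w) M B i = (om i s == w)%:R * (n%:R / 4%:R) * weight c M B i.
Proof.
move=> sD cs n0; rewrite /weight [RHS]mulrA; congr (_ * _).
rewrite (bigD1 s) //= [in RHS](bigD1 s) //= [RHS]mulrA; congr (_ * _); last first.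
  by apply: eq_bigr => s' /andP[_ ss']; rewrite /slot_weight ffunE (negPf ss').
rewrite /slot_weight ffunE eqxx cs.
have nn : n%:R != 0 :> rat by rewrite pnatr_eq0 -lt0n.
by field.
Qed.

Lemma weight_unassigned c M B s w i : s \notin D i ->
  weight (assign c s w) M B i = weight c M B i.
Proof.
move=> sD; rewrite /weight; congr (_ * _); apply: eq_bigr => s' s'D.
by rewrite /slot_weight ffunE ifN //; apply: contraNneq sD => <-.
Qed.

Definition edge_weight c M B e : rat := \sum_(i | P i && (e \in E i)) weight c M B i.

Section Cycle.
Variables (c : {ffun slot -> option V}) (M B : {set V * V}) (f : V * V).
Hypothesis f_max : forall e, e \in free M B -> edge_weight c M B e <= edge_weight c M B f.

Let alive i := P i && (f \notin E i).

Lemma total_weight_split :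
  total_weight c M B = edge_weight c M B f + \sum_(i | alive i) weight c M B i.
Proof.
rewrite /total_weight (bigID (fun i => f \in E i)) /=.
by congr (_ + _); apply: eq_bigl => i; rewrite /alive.
Qed.

(** Maker's hit removes the weight at [f]. No edge free at the start of the cycle carries more than
    [f], so the edges of [S] add at most #|S|/N times that weight. *)
Lemma alive_growth S : S \subset free M B -> (#|S| <= N)%N ->
  \sum_(i | alive i) weight c M B i * (1 + #|E i :&: S|%:R / N%:R)
    <= total_weight c M B.
Proof.
move=> sS cS; rewrite total_weight_split.
under eq_bigr do rewrite mulrDr mulr1 mulrA.
rewrite big_split /= addrC lerD2r -mulr_suml ler_pdivrMr ?ltr0n //.
apply: (@le_trans _ _ (#|S|%:R * edge_weight c M B f)).
  apply: sum_incidence => e eS; apply: le_trans (f_max (subsetP sS _ eS)).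
  rewrite /edge_weight [leRHS](bigID (fun i => f \in E i)) /= addrC.
  rewrite (eq_bigl (fun i => P i && (e \in E i) && (f \notin E i))).
    by rewrite lerDl sumr_ge0 // => i _; apply: weight_ge0.
  by move=> i; rewrite /alive andbAC.
rewrite mulrC ler_wpM2l ?ler_nat // sumr_ge0 // => i _; exact: weight_ge0.
Qed.

Lemma total_weight_hit M' S : f |: M \subset M' -> S \subset free M B ->
  (#|S| <= N)%N -> total_weight c M' (B :|: S) <= total_weight c M B.
Proof.
rewrite subUset sub1set => /andP[fM' sM] sS cS.
apply: le_trans (alive_growth sS cS).
rewrite /total_weight (bigID (fun i => f \in E i)) /= big1 ?add0r; last first.
  by move=> i /andP[_ fE]; exact: weight_hit fM' fE.
by apply: ler_sum => i _; exact: weight_step.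
Qed.

(* The factor 4 of [slot_weight] pays both for choosing among at least half of the
   vertices and for the growth by Breaker's moves during the cycle. *)
Lemma total_weight_assign s (F : {set V}) : c s = None -> (0 < n)%N ->
  (n <= 2 * #|F|)%N ->
  exists2 w, w \in F & forall M' S, f |: M \subset M' -> S \subset free M B ->
    (#|S| <= N)%N -> total_weight (assign c s w) M' (B :|: S) <= total_weight c M B.
Proof.
move=> cs n0 Fn.
pose a i := if s \in D i then weight c M B i else 0.
have a0 i : 0 <= a i by rewrite /a; case: ifP => // _; exact: weight_ge0.
pose G w := \sum_(i | alive i) (om i s == w)%:R * a i.
have F0 : (0 < #|F|)%N by lia.
(* Each witness prescribes a single value at [s], so on average a vertex of [F] agrees with at most
   a 1/#|F| share of the weight. *)
have [w wF wG] : exists2 w, w \in F & G w * #|F|%:R <= \sum_(i | alive i) a i.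
  apply: ex_le_average => //; rewrite exchange_big /=; apply: ler_sum => i _.
  rewrite -mulr_suml -[leRHS]mul1r ler_wpM2r //.
  rewrite -natr_sum -[leRHS]/(1%:R) ler_nat -big_mkcondr /= sum1_card.
  rewrite (eq_card (_ : _ =i [predI F & pred1 (om i s)])).
    rewrite -(card1 (om i s)); apply/subset_leq_card/subsetP => y.
    by rewrite inE => /andP[].
  by move=> y; rewrite !inE eq_sym.
exists w => // M' S; rewrite subUset sub1set => /andP[fM' sM] sS cS.
have step i : weight (assign c s w) M' (B :|: S) i <=
    weight (assign c s w) M B i * (1 + #|E i :&: S|%:R / N%:R) by exact: weight_step.
apply: le_trans (alive_growth sS cS).
rewrite /total_weight (bigID (fun i => f \in E i)) /= big1 ?add0r; last first.
  by move=> i /andP[_ fE]; exact: weight_hit fM' fE.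
pose r i := weight c M B i * (1 + #|E i :&: S|%:R / N%:R).
pose r' i := if s \in D i then 0 else r i.
have r_ge i : a i + r' i <= r i.
  rewrite /a /r' /r; case: ifP => _; rewrite ?addr0 ?add0r //.
  by rewrite ler_peMr ?weight_ge0 // lerDl divr_ge0 ?ler0n.
apply: (@le_trans _ _ (\sum_(i | alive i) (a i + r' i))); last first.
  by apply: ler_sum => i _; exact: r_ge.
(* Breaker's edges cost a factor at most 2, turning n/4 into n/2, which is at most #|F|. *)
have le2 i : 1 + #|E i :&: S|%:R / N%:R <= 2 :> rat.
  rewrite -[leRHS]/(1 + 1) lerD2l ler_pdivrMr ?ltr0n // mul1r ler_nat.
  by apply: leq_trans cS; rewrite subset_leq_card // subsetIr.
apply: (@le_trans _ _ (\sum_(i | alive i)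
    ((om i s == w)%:R * a i * (n%:R / 2) + r' i))).
  apply: ler_sum => i _; apply: le_trans (step i) _.
  rewrite /a /r'; have [sD|sD] := boolP (s \in D i); last first.
    by rewrite weight_unassigned // mulr0 mul0r add0r.
  rewrite weight_assign // addr0.
  have := weight_ge0 c M B i; have := le2 i; have := n_ge0.
  have : (0 : rat) <= (om i s == w)%:R by exact: ler0n.
  move: (weight c M B i) (_%:R / N%:R) (n%:R : rat) ((om i s == w)%:R : rat).
  move=> W z m t t0 m0 z2 W0; have tmW : 0 <= t * m * W by rewrite !mulr_ge0.
  rewrite (_ : _ * _ * (m / 2) = t * m * W / 4 * 2); last by field.
  rewrite (_ : t * (m / 4) * W * _ = t * m * W / 4 * (1 + z)); last by field.
  by rewrite ler_wpM2l // divr_ge0.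
rewrite !big_split /= lerD2r -mulr_suml -/(G w); apply: le_trans wG.
have G0 : 0 <= G w by rewrite sumr_ge0 // => i _; rewrite mulr_ge0 ?ler0n.
rewrite ler_wpM2l // ler_pdivrMr // -natrM ler_nat; lia.
Qed.

End Cycle.

(** * The danger of vertices with open choices *)

Definition claimed M B x : nat := #|(M :|: B) :&: incident [set x]|.

Definition chosen c x : nat := #|[set j | c (x, j) != None]|.

Definition unfinished c x : bool := [exists j, c (x, j) == None].

(** Measures how far the claimed edges at [x] run ahead of its choices; a bound on the sum forces
    every vertex to choose early. *)
Definition danger c M B x : rat := g ^+ claimed M B x / 2 ^+ chosen c x.

Definition total_danger c M B : rat := \sum_(x | unfinished c x) danger c M B x.

Lemma danger_ge0 c M B x : 0 <= danger c M B x.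
Proof. by rewrite divr_ge0 ?exprn_ge0 // ltW. Qed.

Lemma danger_step c M B M' B' S x : M' :|: B' \subset (M :|: B) :|: S ->
  (#|S| <= N)%N ->
  danger c M' B' x <= danger c M B x * (1 + #|incident [set x] :&: S|%:R / N%:R).
Proof.
move=> sub cS; rewrite /danger mulrAC ler_wpM2r ?invr_ge0 ?exprn_ge0 //.
have cxS : (#|incident [set x] :&: S| <= N)%N.
  by apply: leq_trans cS; rewrite subset_leq_card // subsetIr.
apply: le_trans (ler_wpM2l _ (growth_le N_gt0 cxS)); last first.
  by rewrite exprn_ge0 // ltW.
rewrite -exprD; apply: ler_weXn2l; first exact: growth_ge1.
rewrite /claimed (setIC (incident [set x]) S).
apply: leq_trans (leq_card_setU _ _).
by rewrite -setIUl subset_leq_card // setSI.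
Qed.

Lemma danger_assign c M B x j w : c (x, j) = None ->
  danger (assign c (x, j) w) M B x = danger c M B x / 2.
Proof.
move=> cx; rewrite /danger -mulrA -invfM -exprSr; do 3 congr (_ _).
rewrite /chosen.
rewrite (_ : [set j' | _] = j |: [set j' | c (x, j') != None]).
  by rewrite cardsU1 inE cx eqxx.
apply/setP=> j'; rewrite !inE ffunE /= xpair_eqE eqxx /=.
by case: (j' == j).
Qed.

Lemma danger_unassigned c M B x y j w : y != x ->
  danger (assign c (x, j) w) M B y = danger c M B y.
Proof.
move=> yx; rewrite /danger; do 3 congr (_ _); rewrite /chosen.
by apply: eq_card => j'; rewrite !inE ffunE xpair_eqE (negPf yx).
Qed.


(** Each edge of [S] meets two vertices, so with 4#|S| <= N the dangers grow in total by at most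
    half the largest one, which halving the danger of [x] repays. *)
Lemma total_danger_assign c M B M' B' S x j w :
  (forall y, unfinished c y -> danger c M B y <= danger c M B x) ->
  unfinished c x -> c (x, j) = None -> (4 * #|S| <= N)%N ->
  M' :|: B' \subset (M :|: B) :|: S ->
  total_danger (assign c (x, j) w) M' B' <= total_danger c M B.
Proof.
move=> xmax ux cx cS sub; set c' := assign c _ w.
have cS' : (#|S| <= N)%N by lia.
have uc' y : unfinished c' y -> unfinished c y.
  move=> /existsP[j']; rewrite ffunE; case: ifP => // _ h.
  by apply/existsP; exists j'.
pose a y := danger c M B y; pose t y := #|incident [set y] :&: S|%:R / N%:R : rat.
have t0 y : 0 <= t y by rewrite divr_ge0 ?ler0n.
have a0 y : 0 <= a y by exact: danger_ge0.
have incr : \sum_(y | unfinished c y) a y * t y <= a x / 2.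
  under eq_bigr do rewrite mulrA.
  rewrite -mulr_suml ler_pdivrMr ?ltr0n //.
  apply: (@le_trans _ _ (#|S|%:R * (2%:R * a x))).
    apply: sum_incidence => e eS.
    apply: (@le_trans _ _ (\sum_(y in [set e.1; e.2]) a x)); last first.
      rewrite sumr_const -[leLHS]mulr_natl ler_wpM2r // ler_nat cards2.
      by case: (_ != _).
    rewrite [leLHS]big_mkcond [leRHS]big_mkcond /=; apply: ler_sum => y _.
    rewrite !inE ![y == _]eq_sym; case: ifP => [/andP[uy ->]|_].
      exact: xmax.
    by case: ifP.
  have : (4 * #|S|)%:R <= N%:R :> rat by rewrite ler_nat.
  rewrite natrM; have := a0 x.
  by move: (a x) (#|S|%:R : rat) (N%:R : rat) => A z m; nra.
rewrite {1}/total_danger.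
apply: (@le_trans _ _ (\sum_(y | unfinished c y)
    (a y * t y + if y == x then a y / 2 else a y))).
  rewrite big_mkcond [leRHS]big_mkcond /=; apply: ler_sum => y _.
  have nn : 0 <= a y * t y + if y == x then a y / 2 else a y.
    by apply: addr_ge0; [exact: mulr_ge0 | case: (y == x) => //; exact: divr_ge0].
  have [uy|_] := boolP (unfinished c' y); last by case: (unfinished c y).
  rewrite (uc' _ uy); apply: le_trans (danger_step c' y sub cS') _.
  have [->|yx] := eqVneq y x; last first.
    by rewrite danger_unassigned // mulrDr mulr1 addrC.
  rewrite danger_assign // -/(a x) -/(t x).
  by have := a0 x; have := t0 x; nra.
rewrite big_split /= -lerBrDl -subr_ge0.
rewrite /total_danger (bigD1 x) //= [X in _ - _ - X](bigD1 x) //= eqxx.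
rewrite -/(a x).
have -> : \sum_(y | unfinished c y && (y != x)) (if y == x then a y / 2 else a y) =
          \sum_(y | unfinished c y && (y != x)) danger c M B y.
  by apply: eq_bigr => y /andP[_ /negPf->].
by move: incr; lra.
Qed.

Definition open_nbrs M B x : {set V} := [set w | (x != w) && (edge x w \in free M B)].

Lemma card_open_nbrs M B x : (n <= #|open_nbrs M B x| + claimed M B x + 1)%N.
Proof.
pose C := [set w | edge x w \in (M :|: B) :&: incident [set x]].
have cC : (#|C| <= claimed M B x)%N.
  have inj : {in C &, injective (edge x)}.
    by move=> w w' _ _ /edge_eq[] [] // -> ->.
  rewrite -(card_in_imset inj); apply/subset_leq_card/subsetP=> e.
  by case/imsetP=> w; rewrite inE => h ->.
have : setT \subset (open_nbrs M B x :|: C) :|: [set x].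
  apply/subsetP=> w _; have [<-|xw] := eqVneq x w; first by rewrite !inE eqxx !orbT.
  rewrite !in_setU; have [h|] := boolP (edge x w \in M :|: B).
    by rewrite [w \in C]inE in_setI h incident_edge set11 orbT.
  by rewrite [w \in open_nbrs _ _ _]inE in_unclaimed edge_Kn xw in_setU negb_or => ->.
move/subset_leq_card; rewrite cardsT card_ord => h.
apply: leq_trans h _; apply: leq_trans (leq_card_setU _ _) _.
rewrite cards1 leq_add2r; apply: leq_trans (leq_card_setU _ _) _.
by rewrite leq_add2l.
Qed.

Variable K : nat.
Hypothesis K_large : (n * 2 ^ d <= 2 ^ K)%N.
Hypothesis n_large : (2 * (2 * N * K + N + 1) <= n)%N.
Hypothesis E_Kn : forall i, P i -> E i \subset Kn.
Hypothesis few_witnesses :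
  \sum_(i | P i) (4%:R / n%:R) ^+ #|D i| * g ^- #|E i| < 1 :> rat.

Let n_gt0 : (0 < n)%N. Proof. lia. Qed.

(** With 2NK claimed edges and an open slot the danger would exceed 2^K / 2^d >= n. *)
Lemma claimed_unfinished c M B x : total_danger c M B <= n%:R ->
  unfinished c x -> (claimed M B x < 2 * N * K)%N.
Proof.
move=> dng ux; rewrite ltnNge; apply/negP=> big.
have ch : (chosen c x < d)%N.
  case/existsP: ux => j cj; rewrite -[ltnRHS](card_ord d) -[ltnRHS]cardsT.
  apply/proper_card/properP; split; first exact: subsetT.
  by exists j; rewrite inE ?cj.
have dx : danger c M B x <= n%:R.
  apply: le_trans dng; rewrite /total_danger (bigD1 x) //= lerDl sumr_ge0 // => y _.
  exact: danger_ge0.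
move: dx; rewrite /danger ler_pdivrMr ?exprn_gt0 // => dx.
have gK : 2 ^+ K <= g ^+ claimed M B x.
  by apply: le_trans (growth_double N_gt0 K) _; rewrite ler_weXn2l // growth_ge1.
have := le_trans gK dx; rewrite -!natrX -natrM ler_nat => h.
have : (n * 2 ^ chosen c x < n * 2 ^ d)%N by rewrite ltn_pmul2l // ltn_exp2l.
lia.
Qed.

Definition position c M B : Prop := [/\ total_weight c M B < 1,
  total_danger c M B <= n%:R &
  forall s w, c s = Some w -> (s.1 != w) && (edge s.1 w \in M)].

(* Maker alternates between hitting the pair of maximal weight and choosing
   an out-neighbour of a vertex of maximal danger. *)
Definition midcycle c M B M' B' : Prop := exists f S,
  [/\ position c M B, f \in free M B,
      forall e, e \in free M B -> edge_weight c M B e <= edge_weight c M B f,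
      S \subset free M B :\ f & [/\ (#|S| <= b)%N, M' = f |: M & B' = B :|: S]].

Lemma hit_step c M B : position c M B -> free M B != set0 ->
  exists2 f, f \in free M B & forall S, S \subset free M B :\ f -> (#|S| <= b)%N ->
    midcycle c M B (f |: M) (B :|: S).
Proof.
move=> pos /set0Pn F0; have [f fF fmax] := ex_argmax (edge_weight c M B) F0.
by exists f => // S sS cS; exists f, S.
Qed.

Lemma midcycle_unclaimed c M B M' B' : midcycle c M B M' B' ->
  free M' B' \subset free M B.
Proof.
move=> [f [S [_ _ _ _ [_ -> ->]]]].
by apply/setDS/setUSS; [exact: subsetUr | exact: subsetUl].
Qed.

(** Once all choices are made, the hit alone is a full cycle and the danger sum is empty. *)
Lemma midcycle_position c M B M' B' : midcycle c M B M' B' ->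
  [\/ exists x, unfinished c x | position c M' B'].
Proof.
move=> [f [S [[wt dng adjc] fF fmax sS [cS -> ->]]]].
have [/existsP ex|nex] := boolP [exists x, unfinished c x]; first by left.
right; split.
- apply: le_lt_trans wt; apply: (total_weight_hit fmax (subxx _)).
    by apply: subset_trans sS _; exact: subD1set.
  by clear -cS; rewrite /pace; lia.
- rewrite /total_danger big_pred0 ?ler0n // => x.
  by apply: contraNF nex => ux; apply/existsP; exists x.
- by move=> s w /adjc/andP[-> h]; rewrite inE h orbT.
Qed.

(** By [claimed_unfinished] and [n_large], at least half of all vertices are open neighbours of the
    most endangered [x]; averaging picks [w] among them. Both potentials are compared with the start
    of the cycle, charging both rounds at once. *)
Lemma choice_step c M B M' B' : midcycle c M B M' B' ->
  (exists x, unfinished c x) ->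
  exists2 e, e \in free M' B' & forall S, S \subset free M' B' :\ e ->
    (#|S| <= b)%N -> exists c', position c' (e |: M') (B' :|: S).
Proof.
move=> mid ex; have sF := midcycle_unclaimed mid.
move: mid => [f [S1 [[wt dng adjc] fF fmax sS1 [cS1 M'E B'E]]]].
have [x ux xmax] := ex_argmax (danger c M B) ex.
have /existsP[j /eqP cj] := ux.
have clx := claimed_unfinished dng ux.
have clx' : (claimed M' B' x <= claimed M B x + b.+1)%N.
  have cS1' : (#|f |: S1| <= b.+1)%N by rewrite cardsU1 -add1n leq_add // leq_b1.
  apply: leq_trans (leq_add (leqnn _) cS1').
  apply: leq_trans (leq_card_setU _ _); apply/subset_leq_card/subsetP => e.
  case/setIP=> h hx; rewrite in_setU in_setI hx andbT; move: h.
  rewrite M'E B'E !inE; case: (e == f); case: (e \in M); case: (e \in B);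
    by rewrite ?orbT.
have cF := card_open_nbrs M' B' x.
have Fn : (n <= 2 * #|open_nbrs M' B' x|)%N.
  have arith X m a a' : (2 * (X + N + 1) <= n -> a < X -> a' <= a + b.+1 ->
      n <= m + a' + 1 -> n <= 2 * m)%N by clear; rewrite /pace; lia.
  exact: arith n_large clx clx' cF.
have [w wF hw] := total_weight_assign fmax cj n_gt0 Fn.
move: wF; rewrite inE => /andP[xw eF].
exists (edge x w) => // S2 sS2 cS2; exists (assign c (x, j) w).
have S12 : S1 :|: S2 \subset free M B.
  rewrite subUset (subset_trans sS1 (subD1set _ _)).
  exact: subset_trans (subset_trans sS2 (subD1set _ _)) sF.
have cS12 : (#|S1 :|: S2| <= 2 * b)%N.
  by apply: leq_trans (leq_card_setU _ _) _; rewrite mul2n -addnn leq_add.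
rewrite M'E B'E -setUA; split.
- by apply: le_lt_trans wt; apply: hw => //; rewrite ?subsetUr // /pace; clear -cS12; lia.
- apply: le_trans dng.
  apply: (@total_danger_assign _ _ _ _ _ ([set edge x w; f] :|: (S1 :|: S2))) => //.
    apply: (@leq_trans (4 * (2 + 2 * b))); last by clear; rewrite /pace; lia.
    rewrite leq_mul2l; apply: leq_trans (leq_card_setU _ _) _.
    by rewrite leq_add // cards2; case: (_ != _).
  apply/subsetP=> e; rewrite !inE.
  case: (e == f); case: (e \in M); case: (e \in B); case: (e == edge x w);
    by rewrite ?orbT.
- move=> s w'; rewrite ffunE; case: eqP => [-> [<-]|_ /adjc/andP[-> h]].
    by rewrite xw setU11.
  by rewrite !inE h !orbT.
Qed.

Lemma board_not_full M B x : free M B = set0 -> (n <= claimed M B x + 1)%N.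
Proof.
move=> F0; have := card_open_nbrs M B x.
rewrite (_ : open_nbrs M B x = set0) ?cards0 //.
by apply/setP=> w; rewrite inE F0 !inE andbF.
Qed.

Definition respected M (C : slot -> V) : Prop :=
  (forall s, (s.1 != C s) && (edge s.1 (C s) \in M)) /\
  forall i, P i -> {in D i, om i =1 C} -> ~~ [disjoint M & E i].

(** On a full board an open slot contradicts [claimed_unfinished], as n - 1 edges at its vertex are
    claimed. A realised witness would have weight 1, but the total is below 1. *)
Lemma position_end c M B : position c M B -> free M B = set0 ->
  exists C, respected M C.
Proof.
move=> [wt dng adjc] F0.
have fin s : c s != None.
  apply/negP=> cs; have ux : unfinished c s.1.
    by apply/existsP; exists s.2; rewrite -surjective_pairing.
  have := board_not_full s.1 F0; have := claimed_unfinished dng ux.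
  by clear -n_large; lia.
(* The default [s.1] is never taken, by [fin]. *)
pose C s := odflt s.1 (c s).
have CE s : c s = Some (C s) by rewrite /C; case: (c s) (fin s).
exists C; split=> [s|i Pi iC]; first exact: adjc.
apply/negP=> dME; have := wt; apply/negP; rewrite -leNgt.
rewrite /total_weight (bigD1 i) //=.
have -> : weight c M B i = 1.
  rewrite /weight dME big1 ?mul1r => [|s sD]; last first.
    by rewrite /slot_weight CE iC // eqxx.
  rewrite (_ : E i :\: B = set0) ?cards0 ?expr0 ?invr1 //.
  apply/eqP; rewrite -subset0 -F0; apply/subsetP=> e; rewrite inE => /andP[eB eE].
  by rewrite in_unclaimed eB (subsetP (E_Kn Pi)) // (disjointFl dME).
by rewrite lerDl sumr_ge0 // => i' _; exact: weight_ge0.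
Qed.

Lemma midcycle_end c M B M' B' : midcycle c M B M' B' -> free M' B' = set0 ->
  exists C, respected M' C.
Proof.
move=> mid F0; have [ex|pos] := midcycle_position mid; last exact: position_end pos F0.
by have [e] := choice_step mid ex; rewrite F0 inE.
Qed.

Lemma position_start : position [ffun=> None] set0 set0.
Proof.
split; last by move=> s w; rewrite ffunE.
- apply: le_lt_trans few_witnesses; apply: ler_sum => i _.
  rewrite /weight -setI_eq0 set0I eqxx setD0 ler_wpM2r //.
    by rewrite invr_ge0 exprn_ge0 // ltW.
  rewrite (eq_bigr (fun=> 4%:R / n%:R)) ?prodr_const // => s _.
  by rewrite /slot_weight ffunE.
- rewrite -[in leRHS](card_ord n) -sumr_const [leLHS]big_mkcond.
  apply: ler_sum => x _; case: ifP => // _.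
  rewrite /danger /claimed /chosen setU0 set0I cards0 expr0.
  rewrite (_ : [set j | _] = set0) ?cards0 ?expr0 ?divr1 //.
  by apply/setP=> j; rewrite !inE ffunE.
Qed.

Theorem maker_wins_witness (W : {set V * V} -> Prop) :
  (forall M C, respected M C -> W M) -> maker_wins Kn W b.
Proof.
move=> respected_W.
apply: (@maker_strategy _ _ _ _ (fun M B =>
  (exists c, position c M B) \/ exists c M0 B0, midcycle c M0 B0 M B)).
- move=> M B [[c pos]|[c [M0 [B0 mid]]]] F0.
    have [f fF hf] := hit_step pos F0; exists f => // S sS cS; right.
    by exists c, M, B; exact: hf.
  have [ex|pos] := midcycle_position mid.
    have [e eF he] := choice_step mid ex; exists e => // S sS cS; left.
    exact: he.
  have [f fF hf] := hit_step pos F0; exists f => // S sS cS; right.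
  by exists c, M, B; exact: hf.
- move=> M B [[c pos]|[c [M0 [B0 mid]]]] F0.
    by have [C /respected_W] := position_end pos F0.
  by have [C /respected_W] := midcycle_end mid F0.
- by left; exists [ffun=> None]; exact: position_start.
Qed.

End MakerPotential.

(** * Counting subsets *)

Lemma bin_le_exp n k : ('C(n, k) <= n ^ k)%N.
Proof.
apply: (@leq_trans (n ^_ k)).
  by rewrite -bin_ffact leq_pmulr // fact_gt0.
by elim: k => // k IH; rewrite ffactnSr expnSr leq_mul // leq_subr.
Qed.

(** Expanding (1 + t)^#|A| over subsets leaves this sum plus 1 for the empty set; [growth_le] bounds
    the power. *)
Lemma sum_nonempty_subsets (A : finType) (N : nat) (t : rat) :
  (0 < N)%N -> (#|A| <= N)%N -> 0 <= t -> t <= (2 * N)%:R^-1 ->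
  \sum_(S : {set A} | (0 < #|S|)%N) t ^+ #|S| <= #|A|%:R / N%:R.
Proof.
move=> N0 AN t0 tN.
have : (1 + t) ^+ #|A| <= 1 + #|A|%:R / N%:R.
  apply: le_trans (growth_le N0 AN); apply: lerXn2r.
  - by rewrite nnegrE addr_ge0.
  - by rewrite nnegrE ltW // growth_gt0.
  - by rewrite lerD2l.
rewrite -prodr_const (eq_bigl predT) // addrC bigA_distr.
rewrite (bigID (fun S : {set A} => (0 < #|S|)%N)) /=.
rewrite [X in _ + X](big_pred1 set0) => [|S]; last by rewrite /= lt0n negbK cards_eq0.
rewrite [X in _ + X]big1 => [|x _]; last by rewrite inE.
rewrite addrC lerD2l; congr (_ <= _); apply: eq_bigr => S _.
by rewrite -big_mkcond prodr_const.
Qed.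

Lemma card_between_disjoint n (A T : {set 'I_n}) :
  [disjoint A & T] -> #|between A T| = (#|A| * #|T|)%N.
Proof.
move=> AT; rewrite /between curry_imset2X card_in_imset ?cardsX //.
move=> [x y] [z w]; rewrite !inE /= => /andP[xA yT] /andP[zA wT].
case/edge_eq=> [[-> -> //]|[xw _]].
by move: wT; rewrite -xw (disjointFr AT).
Qed.

(** * Expanding and linked out-neighbourhoods *)

Section MakerSide.
Import mathcomp.algebra_tactics.ring mathcomp.algebra_tactics.lra.
Variables (n q d m b r : nat) (x0 : 'I_n).
Notation V := 'I_n.
Notation slot := ('I_n * 'I_d)%type.
Notation Kn := (Kn_edges n).
Notation N := (pace b).
Hypothesis q_gt0 : (0 < q)%N.
Hypothesis qm_le : (q * m <= n)%N.
Hypothesis expansion_bound : (8 * n * (n ^ q * (4 * (q * m)) ^ d) <= n ^ d)%N.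
Hypothesis link_bound1 : (4 * (n ^ (2 * m) * 4 ^ (2 * m * d)) <= 2 ^ r)%N.
Hypothesis link_bound2 : (2 * N * r <= (q * m) ^ 2)%N.

Definition slots_of (S : {set V}) : {set slot} := setX S [set: 'I_d].

Definition image_of (om : slot -> V) (S : {set V}) : {set V} := om @: slots_of S.

(* A witness [inl (S, U, om)] says that the out-neighbours of [S] lie in the small
   set [U]; [inr (S, S', om)] says that Maker missed all edges between the
   out-neighbourhoods of [S] and of [S']. *)
Definition datum : finType := ({set V} * {set V} * {ffun slot -> V})%type.

(** [pffun_on x0] fixes the value [x0] off the slots in question, so tables are counted by their
    values on these slots alone. *)
Definition small (z : datum) : bool :=
  [&& (0 < #|z.1.1| <= m)%N, #|z.1.2| == (q * #|z.1.1|)%N &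
      z.2 \in pffun_on x0 (slots_of z.1.1) z.1.2].

(** Size and disjointness of the images give [target] at least (qm)^2 edges, which makes its Beck
    factor small. *)
Definition unlinked (z : datum) : bool :=
  [&& #|z.1.1| == m, #|z.1.2| == m, [disjoint z.1.1 & z.1.2],
      z.2 \in pffun_on x0 (slots_of (z.1.1 :|: z.1.2)) setT &
      [&& [disjoint image_of z.2 z.1.1 & image_of z.2 z.1.2],
       (q * m <= #|image_of z.2 z.1.1|)%N & (q * m <= #|image_of z.2 z.1.2|)%N]].

Definition valid (i : datum + datum) : bool :=
  match i with inl z => small z | inr z => unlinked z end.

Definition domain (i : datum + datum) : {set slot} :=
  match i with inl z => slots_of z.1.1 | inr z => slots_of (z.1.1 :|: z.1.2) end.

Definition table (i : datum + datum) : slot -> V :=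
  match i with inl z => z.2 | inr z => z.2 end.

Definition target (i : datum + datum) : {set V * V} :=
  match i with
  | inl _ => set0
  | inr z => between (image_of z.2 z.1.1) (image_of z.2 z.1.2)
  end.

Lemma target_Kn i : valid i -> target i \subset Kn.
Proof.
case: i => [z _|z]; first exact: sub0set.
case/and5P=> _ _ _ _ /and3P[dis _ _]; apply/subsetP=> e /imset2P[x y xA yA ->].
by rewrite edge_Kn; apply: contraTneq yA => <-; rewrite (disjointFr dis).
Qed.

Lemma card_slots S : #|slots_of S| = (#|S| * d)%N.
Proof. by rewrite cardsX cardsT card_ord. Qed.

Let n_gt0 : (0 < n)%N. Proof. by apply: leq_ltn_trans (ltn_ord x0). Qed.
Let n0 : (0 : rat) < n%:R. Proof. by rewrite ltr0n. Qed.
Let nX0 k : (0 : rat) < n%:R ^+ k. Proof. exact: exprn_gt0. Qed.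

(** For #|S| = a there are at most n^(qa) sets [U] and (qm)^(ad) tables of weight (4/n)^(ad), in all
    t^a with t <= 1/(8n). Summing over nonempty [S] gives at most n/(4n). *)
Lemma sum_small :
  \sum_(z | small z) (4%:R / n%:R) ^+ #|slots_of z.1.1| <= 4%:R^-1 :> rat.
Proof.
pose t : rat := n%:R ^+ q * (4%:R * (q * m)%:R) ^+ d / n%:R ^+ d.
have t0 : 0 <= t by rewrite divr_ge0 ?mulr_ge0 ?exprn_ge0 ?mulr_ge0 ?ler0n.
have tn : t <= (2 * (4 * n))%:R^-1.
  rewrite /t ler_pdivrMr // ler_pdivlMl ?ltr0n ?muln_gt0 //.
  by rewrite mulnA -!natrX -!natrM -!natrX -!natrM ler_nat.
have n4 : (0 < 4 * n)%N by rewrite muln_gt0.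
have nn4 : (#|{: V}| <= 4 * n)%N by rewrite card_ord leq_pmull.
apply: (@le_trans _ _ (n%:R / (4 * n)%:R)); last first.
  by rewrite natrM invfM mulrCA divff ?mulr1 // pnatr_eq0 -lt0n.
have := sum_nonempty_subsets n4 nn4 t0 tn; rewrite card_ord; apply: le_trans.
pose F (S : {set V}) : rat := (4%:R / n%:R) ^+ (#|S| * d).
pose Q (S : {set V}) := (0 < #|S| <= m)%N.
apply: (@le_trans _ _ (\sum_(S | Q S) \sum_(U : {set V} | #|U| == (q * #|S|)%N)
    \sum_(om in pffun_on x0 (slots_of S) U) F S)).
  under [leRHS]eq_bigr do rewrite pair_big_dep.
  rewrite pair_big_dep /= (reindex (fun p : {set V} * ({set V} * {ffun slot -> V}) =>
    (p.1, p.2.1, p.2.2))) /=; last first.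
    by exists (fun z => (z.1.1, (z.1.2, z.2))) => [[? []]|[[]]].
  by apply: ler_sum => p _; rewrite card_slots.
rewrite [leRHS](bigID (fun S : {set V} => (#|S| <= m)%N)) /= -[leLHS]addr0 lerD //; last first.
  by rewrite sumr_ge0 // => S _; rewrite exprn_ge0.
apply: ler_sum => S /andP[S0 Sm].
apply: (@le_trans _ _ (\sum_(U : {set V} | #|U| == (q * #|S|)%N)
    ((q * m) ^ (#|S| * d))%:R * F S)).
  apply: ler_sum => U /eqP cU; rewrite sumr_const -[leLHS]mulr_natl ler_wpM2r //.
    by rewrite exprn_ge0 // divr_ge0 ?ler0n.
  rewrite ler_nat card_pffun_on cU card_slots.
  have [->|Sd] := posnP (#|S| * d); first by rewrite !expn0.
  by rewrite leq_exp2r // leq_mul2l Sm orbT.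
rewrite sumr_const -[leLHS]mulr_natl.
apply: (@le_trans _ _ (n%:R ^+ (q * #|S|) * (((q * m) ^ (#|S| * d))%:R * F S))).
  rewrite ler_wpM2r ?mulr_ge0 ?ler0n ?exprn_ge0 ?divr_ge0 ?ler0n //.
  rewrite -natrX ler_nat -cardsE card_draws card_ord; exact: bin_le_exp.
rewrite /t /F [(#|S| * d)%N]mulnC !exprM -natrX !exprMn exprVn natrX.
rewrite le_eqVlt; apply/orP; left; apply/eqP.
by rewrite natrX exprM -!mulrA; congr (_ * _); rewrite mulrCA.
Qed.

Lemma card_slots2 (S S' : {set V}) : #|S| = m -> #|S'| = m -> [disjoint S & S'] ->
  #|slots_of (S :|: S')| = (2 * m * d)%N.
Proof.
move=> cS cS' dis; rewrite card_slots cardsU (disjoint_setI0 dis) cards0 subn0.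
by rewrite cS cS' addnn -mul2n.
Qed.

(** There are at most n^(2m) pairs with n^(2md) tables each. Every target has at least (qm)^2 >= 2Nr
    edges, so its factor is at most 2^-r, and [link_bound1] leaves 1/4. *)
Lemma sum_unlinked :
  \sum_(z | unlinked z) (4%:R / n%:R) ^+ #|slots_of (z.1.1 :|: z.1.2)| *
     growth N ^- #|target (inr z)| <= 4%:R^-1 :> rat.
Proof.
have N0 : (0 < N)%N by [].
have g0 : 0 < growth N by exact: growth_gt0.
pose F : rat := (4%:R / n%:R) ^+ (2 * m * d) * 2%:R ^- r.
have F0 : 0 <= F by rewrite mulr_ge0 ?invr_ge0 ?exprn_ge0 ?divr_ge0 ?ler0n.
pose Q (S S' : {set V}) := [&& #|S| == m, #|S'| == m & [disjoint S & S']].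
apply: (@le_trans _ _ (\sum_(p : {set V} * {set V} | Q p.1 p.2)
    \sum_(om in pffun_on x0 (slots_of (p.1 :|: p.2)) setT) F)).
  rewrite pair_big_dep [leLHS]big_mkcond [leRHS]big_mkcond /=.
  apply: ler_sum => z _; have [/and5P[/eqP c1 /eqP c2 dis pf] | _] := boolP (unlinked z).
    case/and3P=> dis' i1 i2; rewrite /Q c1 c2 !eqxx dis pf /=.
    rewrite card_slots2 // /F ler_wpM2l //.
      by rewrite exprn_ge0 // divr_ge0 ?ler0n.
    rewrite lef_pV2 ?posrE ?exprn_gt0 //.
    apply: le_trans (growth_double N0 r) _; apply: ler_weXn2l; first exact: growth_ge1.
    apply: leq_trans link_bound2 _.
    by rewrite /= card_between_disjoint // expnS expn1 leq_mul.
  by case: ifP.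
apply: (@le_trans _ _ (\sum_(p : {set V} * {set V} | Q p.1 p.2)
    (n ^ (2 * m * d))%:R * F)).
  apply: ler_sum => -[S S'] /and3P[/eqP /= c1 /eqP c2 dis].
  by rewrite sumr_const -[leLHS]mulr_natl card_pffun_on cardsT card_ord card_slots2.
rewrite sumr_const -[leLHS]mulr_natl.
have cQ : (#|[pred p | Q p.1 p.2]| <= n ^ (2 * m))%N.
  pose D := [set S : {set V} | #|S| == m].
  have cD : (#|D| <= n ^ m)%N by rewrite card_draws card_ord bin_le_exp.
  apply: (@leq_trans #|setX D D|).
    apply/subset_leq_card/subsetP=> -[S S']; rewrite !inE.
    by case/and3P=> -> ->.
  by rewrite cardsX mul2n -addnn expnD leq_mul.
apply: (@le_trans _ _ ((n ^ (2 * m))%:R * ((n ^ (2 * m * d))%:R * F))).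
  by apply: ler_wpM2r; [exact: mulr_ge0 (ler0n _ _) F0 | rewrite ler_nat].
have -> : (n ^ (2 * m * d))%:R * F = (4 ^ (2 * m * d))%:R / 2%:R ^+ r.
  rewrite /F exprMn !natrX mulrA exprVn mulrCA divff ?mulr1 //.
  by rewrite gt_eqF.
rewrite mulrA -natrM ler_pdivrMr ?exprn_gt0 // ler_pdivlMl //.
by rewrite -natrX -natrM ler_nat.
Qed.

Lemma few_data :
  \sum_(i | valid i) (4%:R / n%:R) ^+ #|domain i| * growth N ^- #|target i| < 1 :> rat.
Proof.
rewrite big_sumType /=.
have -> : \sum_(z | small z) (4%:R / n%:R) ^+ #|slots_of z.1.1| *
    growth N ^- #|@set0 (V * V)%type| =
    \sum_(z | small z) (4%:R / n%:R) ^+ #|slots_of z.1.1| :> rat.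
  by apply: eq_bigr => z _; rewrite cards0 expr0 invr1 mulr1.
by apply: le_lt_trans (lerD sum_small sum_unlinked) _; lra.
Qed.

Section Outcome.
Variables (M : {set V * V}) (C : slot -> V).
Hypothesis resp : respected valid domain table target M C.

Lemma adj_C x j : adj M x (C (x, j)).
Proof.
have /andP[_] := resp.1 (x, j); rewrite /edge /adj /=.
by case: ifP => _ ->; rewrite ?orbT.
Qed.

Definition restrict (T : {set slot}) : {ffun slot -> V} :=
  [ffun s => if s \in T then C s else x0].

Lemma restrictE (T : {set slot}) : {in T, restrict T =1 C}.
Proof. by move=> s sT; rewrite ffunE sT. Qed.

Lemma restrict_image (S T : {set V}) : S \subset T ->
  image_of (restrict (slots_of T)) S = image_of C S.
Proof.
move=> ST; apply: eq_in_imset => s; rewrite inE => /andP[sS _].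
by rewrite restrictE // !inE (subsetP ST).
Qed.

Lemma restrict_pffun (T : {set slot}) (U : {set V}) : C @: T \subset U ->
  restrict T \in pffun_on x0 T U.
Proof.
move=> sU; apply/pffun_onP; split.
  by apply/subsetP=> s; rewrite inE ffunE; case: ifP => // _; rewrite eqxx.
move=> y /imageP[s sT ->]; rewrite restrictE //; apply: (subsetP sU).
exact: imset_f.
Qed.

(** Otherwise the out-neighbours of [S] lie in some [U] of exactly q #|S| vertices: an [inl]
    witness, whose empty target Maker cannot have hit. *)
Lemma expansion (S : {set V}) : (0 < #|S| <= m)%N -> (q * #|S| <= #|image_of C S|)%N.
Proof.
move=> cS; rewrite leqNgt; apply/negP=> lt.
have qS : (q * #|S| <= n)%N.
  by apply: leq_trans qm_le; rewrite leq_mul2l; case/andP: cS => _ ->; rewrite orbT.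
have [U [sU _ cU]] := set_between (subsetT (image_of C S)) (ltnW lt).
rewrite cardsT card_ord (minn_idPl qS) in cU.
have := resp.2 (inl (S, U, restrict (slots_of S))).
rewrite /= -setI_eq0 setI0 eqxx => H; suff : false by []; apply: H.
  by rewrite /small /= cS cU eqxx restrict_pffun.
exact: restrictE.
Qed.

Lemma linked (S S' : {set V}) : #|S| = m -> #|S'| = m -> (0 < m)%N ->
  [disjoint S & S'] -> [disjoint image_of C S & image_of C S'] ->
  exists y z, [/\ y \in image_of C S, z \in image_of C S' & adj M y z].
Proof.
move=> cS cS' m0 dS dC.
pose T := slots_of (S :|: S').
have := resp.2 (inr (S, S', restrict T)).
rewrite /= !restrict_image ?subsetUl ?subsetUr // => H.
have : ~~ [disjoint M & between (image_of C S) (image_of C S')].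
  apply: H; last exact: restrictE.
  rewrite /unlinked /= cS cS' !eqxx dS restrict_pffun ?subsetT //=.
  rewrite !restrict_image ?subsetUl ?subsetUr // dC /=.
  by rewrite -{1}cS -{1}cS' !expansion ?cS ?cS' ?m0 /=.
case/pred0Pn=> e /= /andP[eM /imset2P[y z yC zC eE]]; exists y, z; split=> //.
by move: eM; rewrite eE /edge /adj; case: ifP => _ ->; rewrite ?orbT.
Qed.

Lemma walk_image (S : {set V}) l u : (forall x, x \in S -> walk (adj M) l u x) ->
  forall x, x \in image_of C S -> walk (adj M) l.+1 u x.
Proof.
move=> wS x /imsetP[[y j]]; rewrite inE => /andP[yS _] ->.
by rewrite -addn1; apply: walk_cat (wS y yS) (walk1 (adj_C y j)).
Qed.

Lemma layer l u : (q ^ l <= m)%N ->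
  exists2 S : {set V}, #|S| = (q ^ l)%N & forall x, x \in S -> walk (adj M) l u x.
Proof.
elim: l => [|l IH] ql.
  by exists [set u]; [rewrite cards1 | move=> x /set1P->; exact: walk0].
have ql' : (q ^ l <= m)%N by apply: leq_trans ql; rewrite leq_pexp2l.
have [S cS wS] := IH ql'.
have qC : (q ^ l.+1 <= #|image_of C S|)%N.
  by rewrite expnS -cS expansion // cS ql' expn_gt0 q_gt0.
have c0 : (#|@set0 V| <= q ^ l.+1)%N by rewrite cards0.
have [S' [_ sS' cS']] := set_between (sub0set (image_of C S)) c0.
exists S'; first by rewrite cS' (minn_idPl qC).
by move=> x /(subsetP sS'); exact: walk_image.
Qed.

(** Balls of radius l contain m vertices, and their out-neighbourhoods, at radius l + 1, meet or are
    joined by one edge, unless the balls meet already. *)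
Lemma small_diameter l : m = (q ^ l)%N -> diam_at_most (2 * l.+1 + 1) M.
Proof.
move=> mE u v; rewrite -/(walk (adj M) _ u v).
have m0 : (0 < m)%N by rewrite mE expn_gt0 q_gt0.
have [|S cS wS] := @layer l u; first by rewrite mE.
have [|S' cS' wS'] := @layer l v; first by rewrite mE.
have meet l' (A A' : {set V}) : (l' <= l.+1)%N ->
    (forall x, x \in A -> walk (adj M) l' u x) ->
    (forall x, x \in A' -> walk (adj M) l' v x) -> ~~ [disjoint A & A'] ->
    walk (adj M) (2 * l.+1 + 1) u v.
  move=> ll wA wA' /pred0Pn[x /= /andP[xA xA']].
  have := walk_cat (wA x xA) (walk_sym (adjC M) (wA' x xA')).
  by apply: walkW; clear -ll; lia.
have [dS|] := boolP [disjoint S & S']; last exact: meet (leqnSn l) wS wS'.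
have wC := walk_image wS; have wC' := walk_image wS'.
have [dC|] := boolP [disjoint image_of C S & image_of C S'].
  rewrite -mE in cS cS'; have [y [z [yC zC yz]]] := linked cS cS' m0 dS dC.
  have := walk_cat (walk_cat (wC y yC) (walk1 yz)) (walk_sym (adjC M) (wC' z zC)).
  by apply: walkW; clear; lia.
exact: meet (leqnn _) wC wC'.
Qed.

End Outcome.

Theorem maker_wins_diam s l K : (2 * l.+1 + 1 <= s)%N -> m = (q ^ l)%N ->
  (n * 2 ^ d <= 2 ^ K)%N ->
  (2 * (2 * N * K + N + 1) <= n)%N ->
  maker_wins Kn (diam_at_most s) b.
Proof.
move=> ls mE hK hn; apply: (maker_wins_witness (om := table) hK hn target_Kn few_data).
by move=> M C resp u v; exact: walkW ls (small_diameter resp mE u v).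
Qed.

End MakerSide.

Local Close Scope ring_scope.

(** * The threshold *)

Lemma leq_expW x y e : x <= y -> x ^ e <= y ^ e.
Proof. by case: e => // e xy; rewrite leq_exp2r. Qed.

(** Maker's bias is n / (scale k * q), rounded down. The 2^k absorbs n < (q+1)^k <= (2q)^k, and 512k
    pays for [pace_bound]. *)
Definition scale (k : nat) : nat := 512 * k * 2 ^ k.

Lemma scale_gt0 k : 0 < k -> 0 < scale k.
Proof. by move=> k0; rewrite /scale !muln_gt0 k0 expn_gt0. Qed.

(** * Choice of parameters, with q the integer k-th root of n *)

Section Numerics.
Variables (k q n : nat).
Hypotheses (k_ge2 : 2 <= k) (q_large : scale k <= q).
Hypotheses (q_le : q ^ k <= n) (n_lt : n < q.+1 ^ k).

Let scale_ge : 2048 * k <= scale k.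
Proof.
have : 4 <= 2 ^ k by exact: (@leq_pexp2l 2 2 k).
by rewrite /scale; move: (2 ^ k) => z; clear; nia.
Qed.

Let q_ge : 2048 * k <= q. Proof. exact: leq_trans scale_ge q_large. Qed.
Let q_ge64 : 64 <= q. Proof. by clear -q_ge k_ge2; lia. Qed.
Let q_gt0 : 0 < q. Proof. exact: leq_trans q_ge64. Qed.

Let n_le_double : n <= 2 ^ k * q ^ k.
Proof.
rewrite -expnMn; apply: leq_trans (ltnW n_lt) _; apply: leq_expW.
by clear -q_gt0; lia.
Qed.

Let n_le_exp : n <= 2 ^ (k * q).
Proof.
apply: leq_trans (ltnW n_lt) _; rewrite mulnC expnM; apply: leq_expW.
exact: ltn_expl.
Qed.

Let m := q ^ k.-2.
Let b := n %/ (scale k * q).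

Let qmE : q * m = q ^ k.-1.
Proof. by rewrite /m -expnS; congr (_ ^ _); clear -k_ge2; lia. Qed.

Let qqmE : q * (q * m) = q ^ k.
Proof. by rewrite qmE -expnS; congr (_ ^ _); clear -k_ge2; lia. Qed.

Let qm_ge : q <= q * m.
Proof. by rewrite leq_pmulr // expn_gt0 q_gt0. Qed.

Let b_le : b * scale k <= 2 ^ k * (q * m).
Proof.
rewrite -(leq_pmul2r q_gt0) -mulnA; apply: leq_trans (leq_divM _ _) _.
by apply: leq_trans n_le_double _; rewrite -qqmE -mulnA [q * m * q]mulnC.
Qed.

(** The factor 192 is 2 * 8 * 12: [link_numerics2] needs 2 [pace b] = 16(b+1) times 10mkq + 2 <=
    12kqm. *)
Let pace_bound : 192 * k * b.+1 <= q * m.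
Proof.
have : b * (512 * k) <= q * m.
  have p2 : 0 < 2 ^ k by rewrite expn_gt0.
  rewrite -(leq_pmul2l p2); apply: leq_trans b_le; rewrite /scale.
  by rewrite mulnC -!mulnA.
by move: (q * m) qm_ge => z qz; clear -qz q_ge; nia.
Qed.

(** Since q (qm) = q^k <= n, it suffices that 8 n^(q+1) 4^d <= q^d with d = 2kq. As n <= (2q)^k, a
    power q^(k(q-1)) is left to absorb the constants, and q >= 64 is enough. *)
Lemma expansion_numerics :
  8 * n * (n ^ q * (4 * (q * m)) ^ (2 * k * q)) <= n ^ (2 * k * q).
Proof.
have [d dE] : {d | d = 2 * k * q} by exists (2 * k * q).
rewrite -dE; move: (q * m) qqmE => z zE.
apply: (@leq_trans ((q * z) ^ d)); last by apply: leq_expW; rewrite zE.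
rewrite !expnMn !mulnA leq_mul2r; apply/orP; right.
have nq : n * n ^ q <= (2 ^ k * q ^ k) ^ q.+1 by rewrite -expnS leq_expW.
rewrite -!mulnA [n * _]mulnA.
apply: (@leq_trans (8 * ((2 ^ k * q ^ k) ^ q.+1 * 4 ^ d))).
  by rewrite leq_mul2l leq_mul2r nq orbT.
have qd : q ^ d = (q ^ k) ^ q.+1 * q ^ (k * q.-1).
  by rewrite -expnM -expnD; congr (_ ^ _); rewrite dE; clear -q_gt0; nia.
rewrite qd expnMn; move: ((q ^ k) ^ q.+1) => Q.
rewrite [_ * Q]mulnC -(mulnA Q) mulnCA leq_mul2l.
apply/orP; right.
apply: (@leq_trans (64 ^ (k * q.-1))); last exact: leq_expW.
rewrite -[8]/(2 ^ 3) -[4]/(2 ^ 2) -[64]/(2 ^ 6) -!expnM -!expnD leq_exp2l //.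
by rewrite dE; clear -q_ge64 k_ge2; nia.
Qed.

(** With n <= 2^(kq) the exponents add up to 2mkq + 8mkq + 2, which is the choice of [r]. *)
Lemma link_numerics1 :
  4 * (n ^ (2 * m) * 4 ^ (2 * m * (2 * k * q))) <= 2 ^ (10 * m * k * q + 2).
Proof.
apply: (@leq_trans (4 * ((2 ^ (k * q)) ^ (2 * m) * 4 ^ (2 * m * (2 * k * q))))).
  by rewrite leq_mul2l leq_mul2r leq_expW ?orbT.
rewrite -[4]/(2 ^ 2) -!expnM -!expnD leq_exp2l //.
by clear; nia.
Qed.

Lemma link_numerics2 : 2 * pace b * (10 * m * k * q + 2) <= (q * m) ^ 2.
Proof.
have m0 : 0 < m by rewrite expn_gt0 q_gt0.
have pb := pace_bound; rewrite expnS expn1.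
apply: (@leq_trans (192 * k * b.+1 * (q * m))); last by rewrite leq_mul2r pb orbT.
have : 10 * m * k * q + 2 <= 12 * k * (q * m).
  have : 0 < k * (q * m) by rewrite !muln_gt0 m0 q_gt0 (ltnW k_ge2).
  by clear; nia.
by rewrite /pace; move: (10 * m * k * q + 2) b.+1 => y z; clear; nia.
Qed.

Lemma degree_numerics :
  2 * (2 * pace b * (3 * k * q) + pace b + 1) <= n.
Proof.
have bn : b * (2048 * k * q) <= n.
  apply: leq_trans (leq_divM n (scale k * q)); rewrite leq_mul2l leq_mul2r.
  by rewrite scale_ge !orbT.
have qn : 2048 * k * q <= n.
  apply: leq_trans q_le; rewrite -qqmE; apply: (@leq_trans (q * q)).
    by rewrite leq_mul2r q_ge orbT.
  by rewrite leq_mul2l qm_ge orbT.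
have : 0 < k * q by rewrite muln_gt0 q_gt0 (ltnW k_ge2).
by rewrite /pace; move: bn qn; clear; move: b => y; nia.
Qed.

Lemma maker_wins_numeric s : 2 * k <= s.+1 ->
  maker_wins (Kn_edges n) (diam_at_most s) (n %/ (scale k * q)).
Proof.
move=> ks; have n0 : 0 < n by apply: leq_trans q_le; rewrite expn_gt0 q_gt0.
apply: (@maker_wins_diam n q (2 * k * q) m _ (10 * m * k * q + 2) (Ordinal n0)
  q_gt0 _ expansion_numerics link_numerics1 link_numerics2 s k.-2 (3 * k * q)) => //.
- apply: leq_trans q_le; rewrite -qqmE; exact: leq_pmull.
- by clear -ks k_ge2; lia.
(* [K] is 3kq: kq for n and 2kq for the d slots. *)
- apply: (@leq_trans (2 ^ (k * q) * 2 ^ (2 * k * q))).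
    by rewrite leq_mul2r n_le_exp orbT.
  by rewrite -expnD leq_exp2l //; clear; nia.
exact: degree_numerics.
Qed.

(** With r = k - 1 the excluded length 2r + 2 is 2k. As q^k <= n, the value h = 4(n/q + 1), with n/q
    rounded down, meets both bounds on [h]. *)
Lemma breaker_wins_numeric s : s <= 2 * k ->
  diam_breaker_wins s n (4 * (4 * (n %/ q).+1)).
Proof.
move=> sk; have nq : n < (n %/ q).+1 * q by exact: ltn_ceil.
have qn : q <= n.
  apply: leq_trans q_le; rewrite -qqmE; apply: leq_pmulr.
  by rewrite muln_gt0 q_gt0 expn_gt0 q_gt0.
apply: (@breaker_wins_diam n q _ k.-1).
- by apply: leq_trans qn; apply: leq_trans q_ge64.
- by apply: leq_trans q_ge64.
- by clear -k_ge2; lia.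
- by rewrite -mulnA leq_mul2l ltnW ?orbT.
- rewrite leq_mul2l /= -qmE -(leq_pmul2r q_gt0) [_ * q]mulnC qqmE.
  exact: leq_trans q_le (ltnW nq).
by clear -sk k_ge2; lia.
Qed.

End Numerics.

(** * Monotonicity and existence of the threshold *)

Lemma diam_at_most_mono n s (M M' : {set 'I_n * 'I_n}) :
  M \subset M' -> diam_at_most s M -> diam_at_most s M'.
Proof.
move=> sM dm u v; apply: walk_mono (dm u v) => x y.
by case/orP=> /(subsetP sM) h; rewrite /adj h ?orbT.
Qed.

Lemma diam_breaker_winsW s n b b' :
  b <= b' -> diam_breaker_wins s n b -> diam_breaker_wins s n b'.
Proof.
move=> le bw mw; apply: bw; apply: (maker_winsW _ le mw).
exact: diam_at_most_mono.
Qed.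

(** Breaker's wins are upward closed in [b], so descent from one of them reaches the least;
    [classic] decides each step. *)
Lemma threshold_exists s n b : diam_breaker_wins s n b ->
  exists b0, forall b', diam_breaker_wins s n b' <-> b0 <= b'.
Proof.
elim: b => [|b IH] bw.
  by exists 0 => b'; split=> // _; apply: diam_breaker_winsW bw.
have [/IH//|nbw] := classic (diam_breaker_wins s n b).
exists b.+1 => b'; split; last by move/diam_breaker_winsW; apply.
by move=> bw'; rewrite ltnNge; apply/negP=> /diam_breaker_winsW/(_ bw').
Qed.

Lemma root_floor k n : 0 < k -> exists q, q ^ k <= n < q.+1 ^ k.
Proof.
move=> k0; have ex0 : exists q, q ^ k <= n by exists 0; rewrite exp0n.
have bnd q : q ^ k <= n -> q <= n.
  apply: leq_trans; case: q => // q.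
  by rewrite -{1}[q.+1]expn1 leq_pexp2l.
case: (ex_maxnP ex0 bnd) => q qn qmax; exists q; rewrite qn ltnNge.
by apply/negP=> /qmax; rewrite ltnn.
Qed.

(** Maker wins at n / (scale k * q), so [b0] exceeds it. Breaker wins at 16(n/q + 1), and q <= n
    turns this into 32n/q. *)
Lemma threshold_bounds k s n b0 : 2 <= k -> 2 * k <= s.+1 -> s <= 2 * k ->
  scale k ^ k <= n -> (forall b, diam_breaker_wins s n b <-> b0 <= b) ->
  exists q, [/\ 0 < q, q ^ k <= n < q.+1 ^ k, n <= scale k * q * b0 &
                b0 * q <= 32 * n].
Proof.
move=> k2 ks sk nN b0P; have k0 : 0 < k by apply: ltnW.
have [q /andP[qn nq]] := root_floor n k0.
have sq : scale k <= q.
  by have := leq_ltn_trans nN nq; rewrite ltn_exp2r.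
have s0 := scale_gt0 k0.
have q0 : 0 < q by apply: leq_trans sq.
exists q; split; rewrite ?qn //.
  have mw := maker_wins_numeric k2 sq qn nq ks.
  have lt : n %/ (scale k * q) < b0.
    by rewrite ltnNge; apply/negP=> /b0P; apply.
  have d0 : 0 < scale k * q by rewrite muln_gt0 s0.
  apply: leq_trans (ltnW (ltn_ceil n d0)) _.
  by rewrite mulnC leq_mul2l lt orbT.
have bw := breaker_wins_numeric k2 sq qn sk.
have /b0P b0_le := bw.
have qln : q <= n by apply: leq_trans qn; rewrite -{1}[q]expn1 leq_pexp2l.
apply: leq_trans (leq_mul b0_le (leqnn q)) _.
have := leq_divM n q; move: (n %/ q) => z; clear -qln; nia.
Qed.

(** * Passage to real powers *)

Open Scope R_scope.

Lemma INR_expn q k : INR (expn q k) = INR q ^ k.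
Proof. by elim: k => // k IH; rewrite expnS -multE mult_INR IH. Qed.

Lemma INR_leq m n : leq m n -> INR m <= INR n.
Proof. by move=> /ssrnat.leP; exact: le_INR. Qed.

Lemma Rpower_root k q n : leq 1 k -> leq 1 q -> leq (expn q k) n ->
  leq n (expn q.+1 k) ->
  INR q <= Rpower (INR n) (1 / INR k) <= 2 * INR q.
Proof.
move=> k0 q0 qn nq.
have kR : 0 < INR k by apply: lt_0_INR; apply/ssrnat.ltP.
have qR : 1 <= INR q by apply: (INR_leq q0).
have root x : 0 < x -> Rpower (x ^ k) (1 / INR k) = x.
  move=> x0; rewrite -Rpower_pow // Rpower_mult.
  by rewrite (_ : _ * _ = 1) ?Rpower_1 //; field; lra.
have kinv : 0 <= 1 / INR k by apply: Rlt_le; apply: Rdiv_lt_0_compat; lra.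
have qkR : 0 < INR q ^ k by apply: pow_lt; lra.
have := INR_leq qn; have := INR_leq nq; rewrite !INR_expn S_INR => nqR qnR.
split.
  rewrite -[X in X <= _](root (INR q)); last lra.
  by apply: Rle_Rpower_l.
apply: Rle_trans (_ : INR q + 1 <= _); last lra.
rewrite -[X in _ <= X](root (INR q + 1)); last lra.
by apply: Rle_Rpower_l => //; lra.
Qed.

(* b0 is the threshold bias of D_{s,n}: Breaker wins the (1:b) game iff b >= b0.
   uphalf s = ceil(s/2). *)
Theorem theorem1p10 (s : nat) (hs : leq 3 s) :
  exists c1 c2 : R, 0 < c1 /\ 0 < c2 /\
    exists N : nat, forall n : nat, leq N n ->
      exists b0 : nat,
        (forall b : nat, diam_breaker_wins s n b <-> leq b0 b) /\
        c1 * Rpower (INR n) (1 - 1 / INR (uphalf s)) <= INR b0 /\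
        INR b0 <= c2 * Rpower (INR n) (1 - 1 / INR (uphalf s)).
Proof.
set k := uphalf s.
have k2 : leq 2 k by rewrite /k; lia.
have ks : leq (2 * k) s.+1 by rewrite /k; lia.
have sk : leq s (2 * k) by rewrite /k; lia.
have k0 : leq 1 k by apply: ltnW.
have s0 := scale_gt0 k0.
have sR : 0 < INR (scale k) by apply: lt_0_INR; apply/ssrnat.ltP.
(* Let x = n^(1/k), so q <= x <= 2q. Then n <= scale k * q * b0 gives the first constant, and b0 q
   <= 32n gives 64 = 2 * 32. *)
exists (/ INR (scale k)), 64; split; first exact: Rinv_0_lt_compat.
split; first lra.
(* For such n the integer root q is at least [scale k]. *)
exists (expn (scale k) k) => n nN.
have [b1 bw] : exists b, diam_breaker_wins s n b.
  have [q /andP[qn nq]] := root_floor n k0.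
  have sq : leq (scale k) q by have := leq_ltn_trans nN nq; rewrite ltn_exp2r.
  by eexists; exact: (breaker_wins_numeric k2 sq qn sk).
have [b0 b0P] := threshold_exists bw; exists b0; split=> //.
have [q [q0 /andP[qn nq] lo hi]] := threshold_bounds k2 ks sk nN b0P.
have [xlo xhi] := Rpower_root k0 q0 qn (ltnW nq).
have qR : 1 <= INR q by apply: (INR_leq q0).
have n0 : 0 < INR n.
  by apply: lt_0_INR; apply/ssrnat.ltP; apply: leq_trans nN; rewrite expn_gt0 s0.
rewrite /Rminus Rpower_plus Rpower_1 // Rpower_Ropp.
move: (Rpower (INR n) (1 / INR k)) xlo xhi => x xlo xhi.
move: (scale k) sR lo => c sR lo.
have := INR_leq lo; have := INR_leq hi; rewrite -!multE !mult_INR.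
have -> : INR 32 = 32 by rewrite INR_IZR_INZ.
have b0R : 0 <= INR b0 by exact: pos_INR.
move=> hiR loR; split.
  apply: (Rmult_le_reg_l (INR c * x)); first by apply: Rmult_lt_0_compat; lra.
  have -> : INR c * x * (/ INR c * (INR n * / x)) = INR n by field; lra.
  apply: Rle_trans loR _; apply: Rmult_le_compat_r => //.
  by apply: Rmult_le_compat_l; lra.
apply: (Rmult_le_reg_r x); first lra.
have -> : 64 * (INR n * / x) * x = 64 * INR n by field; lra.
apply: Rle_trans (Rmult_le_compat_l _ _ _ b0R xhi) _; lra.
Qed.
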